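(* Let $n\ge1$ be an integer, $\alpha\in(0,1)$, and let $\Omega_0\subset\mathbb{R}^{n+1}$ be a bounded open convex set with $C^2$ boundary. Let $\{\partial\Omega_t\}$ be the flow of hypersurfaces, starting from $\partial\Omega_0$, moving by fractional mean curvature $H_\alpha$. Then the maximal time $$T^*:=\sup\{t>0:\ \Omega_\tau\text{ is non-empty and has }C^2\text{ boundary for all }\tau\in[0,t)\}$$ satisfies $$T^*\le C\,|\partial\Omega_0|^{\frac{1+\alpha}{n}}$$ for some constant $C$ depending only on $n$ and $\alpha$.
   Context: $|\partial\Omega|$ denotes the $n$-dimensional Hausdorff measure of $\partial\Omega$. The fractional $\alpha$-mean curvature of an open set $\Omega\subset\mathbb{R}^{n+1}$ with exterior unit normal $\nu$ at $x\in\partial\Omega$ is $$H_\alpha[\Omega](x)=\frac{\alpha}{2}\,\mathrm{P.V.}\int_{\mathbb{R}^{n+1}}\frac{\chi_{\mathbb{R}^{n+1}\setminus\Omega}(y)-\chi_\Omega(y)}{|y-x|^{n+1+\alpha}}\,dy=\mathrm{P.V.}\int_{\partial\Omega}\frac{(y-x)\cdot\nu(y)}{|y-x|^{n+1+\alpha}}\,dy,$$ where the first integral is with respect to Lebesgue measure, the second is with respect to the $n$-dimensional Hausdorff measure, and P.V. denotes the principal value. A family of open sets $\{\Omega_t\}_{t\ge0}$ evolves by fractional $\alpha$-mean curvature flow if the inner normal velocity at each point $x\in\partial\Omega_t$ equals $H_\alpha[\Omega_t](x)$; that is, points of the boundary move along differentiable curves $t\mapsto p(t)\in\partial\Omega_t$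 satisfying $\frac{d}{dt}p(t)=-H_\alpha[\Omega_t](p(t))\,\nu_t(p(t))$, where $\nu_t$ is the exterior unit normal to $\partial\Omega_t$. It is a known fact that, for such initial data, $T^*>0$, and that if $\Omega_0$ is convex then $\Omega_t$ is convex for each $t$ along the flow. *)

(* Defs.v *)
From HB Require Import structures.
From mathcomp Require Import all_boot all_order all_algebra.
From mathcomp Require Import all_classical all_reals all_analysis.

Set Implicit Arguments.
Unset Strict Implicit.
Unset Printing Implicit Defensive.

Import Order.TTheory GRing.Theory Num.Theory.
Import numFieldNormedType.Exports.

Local Open Scope classical_set_scope.
Local Open Scope ring_scope.

(* The library norm [`|v|] on row vectors is the sup norm: it has the right
   topology and the right bounded sets, but lengths need the Euclidean norm. *)
Definition enorm (R : realType) (m : nat) (v : 'rV[R]_m) : R :=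
  Num.sqrt (\sum_(i < m) v ord0 i ^+ 2).

Definition boundary (T : topologicalType) (A : set T) : set T :=
  closure A `\` interior A.

(* R^m carries the sigma-algebra generated by the coordinates, that is, its
   Borel sigma-algebra. *)
Definition rV_display : measure_display.
Proof. exact: default_measure_display. Qed.

Section rV_measurable.
Context (R : realType) (m : nat).

Definition rV_coord (i : 'I_m) (v : 'rV[R]_m) : R := v ord0 i.

Let rV_set0 : g_sigma_preimage rV_coord set0.
Proof. exact: sigma_algebra0. Qed.

Let rV_setC A : g_sigma_preimage rV_coord A -> g_sigma_preimage rV_coord (~` A).
Proof. exact: sigma_algebraC. Qed.

Let rV_bigcup (F : (set 'rV[R]_m)^nat) :
  (forall i, g_sigma_preimage rV_coord (F i)) ->
  g_sigma_preimage rV_coord (\bigcup_i (F i)).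
Proof. exact: sigma_algebra_bigcup. Qed.

HB.instance Definition _ := @isMeasurable.Build rV_display
  'rV[R]_m (g_sigma_preimage rV_coord) rV_set0 rV_setC rV_bigcup.

End rV_measurable.

Definition rV_cons (R : realType) (m : nat) (p : R * 'rV[R]_m) : 'rV[R]_m.+1 :=
  row_mx (const_mx p.1 : 'rV[R]_1) p.2.

Lemma measurable_rV_coord (R : realType) (m : nat) (i : 'I_m) :
  measurable_fun [set: 'rV[R]_m] (rV_coord i).
Proof.
move=> _ Y mY; rewrite setTI; apply: sub_sigma_algebra => /=.
rewrite -bigcup_seq/=; exists i => /=; first by rewrite mem_index_enum.
by exists Y => //; rewrite setTI.
Qed.

Lemma measurable_rV_cons (R : realType) (m : nat) :
  measurable_fun [set: R * 'rV[R]_m] (@rV_cons R m).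
Proof.
move=> _ B mB; rewrite setTI.
suff H : g_sigma_preimage (@rV_coord R m.+1) `<=`
    [set A | measurable (@rV_cons R m @^-1` A)] by exact: H.
apply: smallest_sub.
  split => /=.
  - by rewrite preimage_set0.
  - by move=> A /= mA; rewrite setTD preimage_setC; exact: measurableC.
  - by move=> F mF; rewrite preimage_bigcup; exact: bigcup_measurable.
rewrite -bigcup_mkord_ord; apply: bigcup_sub => i Ii A [C mC <-] /=.
rewrite setTI -comp_preimage -[X in measurable X]setTI.
case: (split_ordP (inord i : 'I_(1 + m))) => j Ej.
  rewrite (_ : _ \o _ = fst); first exact: measurable_fst.
  apply/funext => p /=; rewrite /rV_coord /rV_cons Ej.
  by rewrite [LHS](row_mxEl (const_mx p.1 : 'rV_1) p.2) mxE.
rewrite (_ : _ \o _ = rV_coord j \o snd).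
  by apply: (measurableT_comp (@measurable_rV_coord R m j) measurable_snd).
apply/funext => p /=; rewrite /rV_coord /rV_cons Ej.
exact: (row_mxEr (const_mx p.1 : 'rV_1) p.2).
Qed.

Section lebesgue_rV.
Context (R : realType).

Definition rV_uncons m (v : 'rV[R]_m.+1) : R * 'rV[R]_m :=
  (v ord0 ord0, \row_i v ord0 (lift ord0 i)).

Lemma rV_consK m : cancel (@rV_cons R m) (@rV_uncons m).
Proof.
move=> [a v]; rewrite /rV_uncons /rV_cons /=; congr pair.
  have -> : ord0 = lshift m (ord0 : 'I_1) by exact: val_inj.
  by rewrite [LHS](row_mxEl (const_mx a : 'rV_1) v) mxE.
apply/rowP => i; rewrite mxE.
have -> : lift ord0 i = rshift 1 i by exact: val_inj.
exact: (row_mxEr (const_mx a : 'rV_1) v).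
Qed.

Lemma measurable_rV_uncons m : measurable_fun setT (@rV_uncons m).
Proof.
apply: measurable_fun_pair; first exact: (@measurable_rV_coord R m.+1 ord0).
move=> _ B mB; rewrite setTI.
suff H : g_sigma_preimage (@rV_coord R m) `<=`
    [set A | measurable ((snd \o @rV_uncons m) @^-1` A)] by exact: H.
apply: smallest_sub.
  split => /=.
  - by rewrite preimage_set0.
  - by move=> A /= mA; rewrite setTD preimage_setC; exact: measurableC.
  - by move=> F mF; rewrite preimage_bigcup; exact: bigcup_measurable.
case: m {B mB} => [|m]; first by rewrite big_ord0.
rewrite -bigcup_mkord_ord; apply: bigcup_sub => i Ii A [C mC <-] /=.
rewrite setTI -comp_preimage -[X in measurable X]setTI.
rewrite (_ : _ \o _ = rV_coord (lift ord0 (inord i : 'I_m.+1))).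
  exact: measurable_rV_coord.
by apply/funext => v; rewrite /rV_coord /= mxE.
Qed.

Section step.
Context (m : nat) (mu : {sigma_finite_measure set 'rV[R]_m -> \bar R}).

(* Lebesgue measure on R times [mu], transported to R^(m+1). *)
Definition lebesgue_rV_step : set 'rV[R]_m.+1 -> \bar R :=
  pushforward (lebesgue_measure \x mu)%E (@rV_cons R m).

Let step_measure : {measure set 'rV[R]_m.+1 -> \bar R} :=
  measure_function_pushforward__canonical__measure_function_Measure
    (lebesgue_measure \x mu)%E (@measurable_rV_cons R m).

HB.instance Definition _ := Measure.copy lebesgue_rV_step step_measure.

Let step_sigma_finite : sigma_finite setT lebesgue_rV_step.
Proof.
have /sigma_finiteP[F [TF ndF Foo]] := sigma_finiteT (@lebesgue_measure R).
have /sigma_finiteP[G [TG ndG Goo]] := sigma_finiteT mu.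
exists (fun k => @rV_uncons m @^-1` (F k `*` G k)).
  apply/esym; rewrite -subTset => v _.
  have [i _ Fi] : (\bigcup_i F i) (@rV_uncons m v).1 by rewrite -TF.
  have [j _ Gj] : (\bigcup_j G j) (@rV_uncons m v).2 by rewrite -TG.
  exists (maxn i j) => //; split.
  - by move: Fi; exact/subsetPset/ndF/leq_maxl.
  - by move: Gj; exact/subsetPset/ndG/leq_maxr.
move=> k; have [mF F_oo] := Foo k; have [mG G_oo] := Goo k; split.
  rewrite -[X in measurable X]setTI; apply: measurable_rV_uncons => //.
  exact: measurableX.
rewrite /lebesgue_rV_step /pushforward -comp_preimage.
rewrite (_ : _ \o _ = id); last by apply/funext => p /=; exact: rV_consK.
by rewrite preimage_id product_measure1E// lte_mul_pinfty// ge0_fin_numE.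
Qed.

HB.instance Definition _ :=
  Measure_isSigmaFinite.Build _ _ _ lebesgue_rV_step step_sigma_finite.

End step.

Fixpoint lebesgue_rV (m : nat) : {sigma_finite_measure set 'rV[R]_m -> \bar R} :=
  if m is k.+1 then lebesgue_rV_step (lebesgue_rV k) else \d_(0 : 'rV[R]_0).

End lebesgue_rV.

Section hausdorff.
Context (R : realType) (m : nat).
Local Open Scope ereal_scope.

Definition ediam (A : set 'rV[R]_m) : \bar R :=
  ereal_sup ([set 0] `|` [set (enorm (p.1 - p.2)%R)%:E | p in A `*` A]).

Definition hausdorff_delta (n : nat) (delta : R) (A : set 'rV[R]_m) : \bar R :=
  ereal_inf [set \sum_(k <oo) ediam (F k) ^+ n | F in
    [set F : (set 'rV[R]_m)^nat |
      A `<=` \bigcup_k F k /\ forall k, ediam (F k) <= delta%:E]].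

(* The normalising factor, the volume of the unit ball of R^n over 2^n, makes
   the n-dimensional measure the usual n-dimensional area.  Only n >= 1 is
   meant: for n = 0 the empty sets of a cover would be counted. *)
Definition hausdorff (n : nat) (A : set 'rV[R]_m) : \bar R :=
  lebesgue_rV R n [set v | (enorm v < 1)%R] * (2 ^- n)%:E *
  ereal_sup [set hausdorff_delta n delta A | delta in [set d : R | (0 < d)%R]].

End hausdorff.

Section C2_boundary.
Context (R : realType) (m : nat).

Definition partial (i : 'I_m) (f : 'rV[R]_m -> R) : 'rV[R]_m -> R :=
  fun x => 'D_(delta_mx ord0 i) f x.

Definition has_partials (U : set 'rV[R]_m) (f : 'rV[R]_m -> R) : Prop :=
  forall x i, U x -> derivable f x (delta_mx ord0 i).

Definition C2_on (U : set 'rV[R]_m) (f : 'rV[R]_m -> R) : Prop :=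
  [/\ {in U, continuous f},
      has_partials U f,
      forall i, {in U, continuous (partial i f)},
      forall i, has_partials U (partial i f) &
      forall i j, {in U, continuous (partial j (partial i f))}].

Definition gradient (f : 'rV[R]_m -> R) (x : 'rV[R]_m) : 'rV[R]_m :=
  \row_i partial i f x.

(* [rho] is a C^2 defining function of Omega on the neighbourhood U of x. *)
Definition C2_defining (Omega U : set 'rV[R]_m) (rho : 'rV[R]_m -> R)
    (x : 'rV[R]_m) : Prop :=
  [/\ open U, U x, C2_on U rho,
      forall y, U y -> gradient rho y != 0 &
      forall y, U y -> (Omega y <-> rho y < 0)].

Definition has_C2_boundary (Omega : set 'rV[R]_m) : Prop :=
  forall x, boundary Omega x -> exists U rho, C2_defining Omega U rho x.

(* The gradient of a defining function points out of Omega; the normalised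
   gradient does not depend on the choice of (U, rho). *)
Definition exterior_unit_normal (Omega : set 'rV[R]_m) (x nu : 'rV[R]_m) : Prop :=
  exists U rho, C2_defining Omega U rho x /\
    nu = (enorm (gradient rho x))^-1 *: gradient rho x.

End C2_boundary.

Section fractional_mean_curvature.
Context (R : realType) (n : nat) (alpha : R).
Local Notation E := 'rV[R]_n.+1.

(* The integral over the complement of the ball of radius eps about x, whose
   limit as eps decreases to 0 is the principal value. *)
Definition truncated_curvature (Omega : set E) (x : E) (eps : R) : R :=
  \int[lebesgue_rV R n.+1]_(y in [set y | eps <= enorm (y - x)])
    ((\1_(~` Omega) y - \1_Omega y) / enorm (y - x) `^ (n.+1%:R + alpha)).

Definition pv_converges (Omega : set E) (x : E) : Prop :=
  cvg (truncated_curvature Omega x eps @[eps --> 0^'+]).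

Definition frac_mean_curvature (Omega : set E) (x : E) : R :=
  alpha / 2 * lim (truncated_curvature Omega x eps @[eps --> 0^'+]).

End fractional_mean_curvature.

Section flow.
Context (R : realType) (n : nat) (alpha : R).
Local Notation E := 'rV[R]_n.+1.

Definition regular_until (Omega : R -> set E) (t : R) : Prop :=
  0 < t /\ forall tau, 0 <= tau < t ->
    Omega tau !=set0 /\ has_C2_boundary (Omega tau).

Definition maximal_time (Omega : R -> set E) : \bar R :=
  ereal_sup [set t%:E | t in regular_until Omega].

(* Derivative of p at t along times >= 0: two-sided for t > 0, one-sided at
   t = 0. *)
Definition velocity (p : R -> E) (t : R) (v : E) : Prop :=
  h^-1 *: (p (t + h) - p t) @[h --> within [set h | 0 <= t + h] 0^'] --> v.

(* [X x t] is the position at time t of the boundary point starting at x. The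
   equation is asked for on [0, T*[, where the boundaries are C^2 and their
   curvature is defined. *)
Definition frac_mean_curvature_flow (Omega : R -> set E) : Prop :=
  (forall t, 0 <= t -> open (Omega t)) /\
  exists X : E -> R -> E,
    let Tmax := maximal_time Omega in
    [/\ forall x, boundary (Omega 0) x -> X x 0 = x,
        forall t, 0 <= t -> (t%:E < Tmax)%E ->
          [set X x t | x in boundary (Omega 0)] = boundary (Omega t),
        {within [set q : E * R | boundary (Omega 0) q.1 /\
                                 0 <= q.2 /\ (q.2%:E < Tmax)%E],
          continuous (fun q => X q.1 q.2)} &
        forall x t, boundary (Omega 0) x -> 0 <= t -> (t%:E < Tmax)%E ->
          exists nu, [/\ exterior_unit_normal (Omega t) (X x t) nu,
            pv_converges alpha (Omega t) (X x t) &
            velocity (X x) t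
              (- frac_mean_curvature alpha (Omega t) (X x t) *: nu)]].

End flow.

(* Main.v *)
Require Import Defs.
From mathcomp Require Import all_boot all_order all_algebra.
From mathcomp Require Import all_classical all_reals all_analysis.
From mathcomp Require Import perm measurable_realfun ring lra.

Set Implicit Arguments.
Unset Strict Implicit.
Unset Printing Implicit Defensive.

Import Order.TTheory GRing.Theory Num.Theory.
Import numFieldNormedType.Exports.

Local Open Scope classical_set_scope.
Local Open Scope ring_scope.

(** The proof compares the flow with a slab.  Fix a unit vector e, and suppose
    that at time t the boundary of Omega t has width at most W in direction e.
    Let x be a boundary point where <., e> is maximal.  Then Omega t lies in a
    slab of thickness W having x on one face (or its complement does, in which
    case both the curvature and the normal change sign).  The reflection
    y |-> 2x - y preserves the kernel |y - x|^-(n+1+alpha) and, away from the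
    hyperplane through x, never keeps a point of the slab inside the slab.  So
    the truncated curvature integral, once averaged with its reflection, has a
    nonnegative integrand, and this integrand is the kernel itself on a cube of
    size W placed beyond the slab at distance comparable to W.  This gives a
    curvature of at least c W^-alpha ([truncated_slab_bound]), and since the
    normal at x is e, the point x moves inward at no less than that speed
    ([contact_speed]).

    The position of a contact point at slightly earlier times bounds the
    earlier maximum of <., e> from below; hence, by compactness, the maximum
    decreases at rate at least c W^-alpha ([max_decreases]).  Used with an
    arbitrary W this shows that no width ever exceeds its initial value.  Used
    with the initial width W for both e and -e, it shows that the two faces
    approach each other at speed at least 2 c W^-alpha, so the regular flow
    lasts at most a time of order W^(1+alpha) ([flow_extinction]).

    It remains to find a direction in which the initial width W satisfies
    W^n <= C |boundary (Omega 0)|.  In a convex set take a simplex of nearly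
    maximal volume: its barycentric coordinates are bounded on the whole set,
    so the steepest of them provides a direction in which the width is at most
    a dimensional constant times the inradius r ([inradius_width]).  Finally,
    the boundary projects along the first axis onto a set containing an
    n-dimensional cube of size r, whence r^n <= C |boundary (Omega 0)| ([hausdorff_boundary_ge]). *)

(** * The Euclidean product *)

Section dot_product.
Context (R : realType) (m : nat).
Implicit Types u v w : 'rV[R]_m.

Definition dot u v : R := \sum_i u ord0 i * v ord0 i.

Lemma enorm_ge0 v : 0 <= enorm v.
Proof. exact: sqrtr_ge0. Qed.

Lemma enorm_sqr v : enorm v ^+ 2 = dot v v.
Proof. by rewrite /enorm sqr_sqrtr // sumr_ge0 // => i _; rewrite sqr_ge0. Qed.

Lemma coord_le_enorm v i : `|v ord0 i| <= enorm v.
Proof.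
rewrite -sqrtr_sqr ler_sqrt; last by rewrite sumr_ge0 // => j _; rewrite sqr_ge0.
by rewrite (bigD1 i) //= lerDl sumr_ge0 // => j _; rewrite sqr_ge0.
Qed.

Lemma enormN v : enorm (- v) = enorm v.
Proof. by rewrite /enorm; congr Num.sqrt; apply: eq_bigr => i _; rewrite mxE sqrrN. Qed.

Lemma rV_norm_coord v i : `|v ord0 i| <= `|v|.
Proof. by rewrite {2}/Num.norm /= mx_normrE; apply: (le_bigmax_cond _ (fun j => `|v j.1 j.2|) (erefl : xpredT (ord0, i))). Qed.

Lemma dotC u v : dot u v = dot v u.
Proof. by apply: eq_bigr => i _; rewrite mulrC. Qed.

Lemma dotDr u v w : dot u (v + w) = dot u v + dot u w.
Proof. by rewrite /dot -big_split; apply: eq_bigr => i _; rewrite mxE mulrDr. Qed.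

Lemma dotZr u a v : dot u (a *: v) = a * dot u v.
Proof. by rewrite /dot mulr_sumr; apply: eq_bigr => i _; rewrite mxE mulrCA. Qed.

Lemma dotNr u v : dot u (- v) = - dot u v.
Proof. by rewrite -scaleN1r dotZr mulN1r. Qed.

Lemma dotBr u v w : dot u (v - w) = dot u v - dot u w.
Proof. by rewrite dotDr dotNr. Qed.

Lemma dotDl u v w : dot (v + w) u = dot v u + dot w u.
Proof. by rewrite !(dotC _ u) dotDr. Qed.

Lemma dotZl u a v : dot (a *: v) u = a * dot v u.
Proof. by rewrite !(dotC _ u) dotZr. Qed.

Lemma dotNl u v : dot (- v) u = - dot v u.
Proof. by rewrite !(dotC _ u) dotNr. Qed.

Lemma dotvv_ge0 v : 0 <= dot v v.
Proof. by rewrite sumr_ge0 // => i _; rewrite -expr2 sqr_ge0. Qed.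

Lemma dotvv_eq0 v : dot v v = 0 -> v = 0.
Proof.
move=> /eqP; rewrite psumr_eq0; last by move=> i _; rewrite -expr2 sqr_ge0.
move=> /allP H; apply/rowP => i; rewrite mxE.
by have := H i (mem_index_enum i); rewrite /= -expr2 sqrf_eq0 => /eqP.
Qed.

(** Pythagoras; positivity of the left-hand side is the Cauchy-Schwarz inequality
    for a unit vector, and its vanishing characterises the vectors parallel to [u]. *)
Lemma dot_reject u v : dot u u = 1 ->
  dot (v - dot u v *: u) (v - dot u v *: u) = dot v v - dot u v ^+ 2.
Proof.
by move=> u1; rewrite dotBr !dotZr !dotDl !dotNl !dotZl u1 (dotC v u); ring.
Qed.

Lemma dot_le_enorm u v : dot u u = 1 -> `|dot u v| <= enorm v.
Proof.
move=> u1; rewrite -sqrtr_sqr ler_sqrt; last by rewrite sumr_ge0 // => i _; rewrite sqr_ge0.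
by have := dotvv_ge0 (v - dot u v *: u); rewrite dot_reject // subr_ge0.
Qed.

Lemma unit_coord_le1 u i : dot u u = 1 -> `|u ord0 i| <= 1.
Proof.
move=> u1; rewrite (le_trans (coord_le_enorm _ _)) // -[leRHS]sqrtr1 -u1 le_eqVlt.
by apply/orP; left; apply/eqP; congr Num.sqrt; apply: eq_bigr => j _; rewrite expr2.
Qed.

Lemma dot_le_coord u v s : dot u u = 1 -> (forall i, `|v ord0 i| <= s) ->
  `|dot u v| <= m%:R * s.
Proof.
move=> u1 vs; rewrite (le_trans (ler_norm_sum _ _ _)) //.
rewrite -[X in X%:R * _]card_ord -sumr_const mulr_suml ler_sum // => i _.
rewrite mul1r normrM (le_trans _ (vs i)) // ler_piMl //.
exact: unit_coord_le1.
Qed.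

Lemma enorm_le_coord v s : (forall i, `|v ord0 i| <= s) -> enorm v <= m%:R * s.
Proof.
case: (posnP m) => [m0|m0] vs.
  by move: v {vs}; rewrite m0 => v; rewrite /enorm big_ord0 sqrtr0 mul0r.
have s0 : 0 <= s by rewrite (le_trans _ (vs (Ordinal m0))).
rewrite -(@ger0_norm _ (m%:R * s)) ?mulr_ge0 // -sqrtr_sqr ler_sqrt ?sqr_ge0 //.
apply: (@le_trans _ _ (\sum_(i < m) s ^+ 2)).
  by apply: ler_sum => i _; rewrite -[leLHS]real_normK ?num_real // ler_sqr ?nnegrE.
rewrite sumr_const card_ord exprMn -[leLHS]mulr_natl ler_wpM2r ?sqr_ge0 //.
by rewrite -natrX ler_nat expnS expn1 leq_pmulr.
Qed.

End dot_product.

(** * Lebesgue measure on row vectors *)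

Section rV_measure.
Context (R : realType).
Implicit Type m : nat.

Lemma measurable_to_rV d (T : measurableType d) m (D : set T)
    (f : T -> 'rV[R]_m) : measurable D ->
  (forall i, measurable_fun D (fun x => f x ord0 i)) -> measurable_fun D f.
Proof.
move=> mD mf _ B mB.
suff H : g_sigma_preimage (@rV_coord R m) `<=`
    [set A | measurable (D `&` f @^-1` A)] by exact: H.
apply: smallest_sub.
  split => /=.
  - by rewrite preimage_set0 setI0.
  - move=> A /= mA; rewrite setTD preimage_setC -setDE.
    rewrite (_ : D `\` _ = D `\` (D `&` f @^-1` A)); first exact: measurableD.
    by rewrite setDIr setDv set0U.
  - by move=> F mF; rewrite preimage_bigcup setI_bigcupr; exact: bigcup_measurable.
case: m f mf {B mB} => [|m] f mf; first by rewrite big_ord0.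
rewrite -bigcup_mkord_ord; apply: bigcup_sub => i Ii A [C mC <-] /=.
by rewrite setTI; exact: mf.
Qed.

Lemma rV_unconsK m : cancel (@rV_uncons R m) (@rV_cons R m).
Proof.
move=> v; apply/rowP => i; rewrite /rV_cons /rV_uncons /=.
case: (unliftP ord0 i) => [j ->|->].
  have -> : lift ord0 j = rshift 1 j by exact: val_inj.
  rewrite [LHS](row_mxEr (const_mx _ : 'rV_1)) mxE; congr (v _ _).
  exact: val_inj.
have -> : ord0 = lshift m (ord0 : 'I_1) by exact: val_inj.
by rewrite [LHS](row_mxEl (const_mx _ : 'rV_1)) mxE; congr (v _ _); exact: val_inj.
Qed.

Lemma rV_cons0 m (p : R * 'rV[R]_m) : rV_cons p ord0 ord0 = p.1.
Proof. by have := congr1 fst (rV_consK p). Qed.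

Lemma rV_consS m (p : R * 'rV[R]_m) i : rV_cons p ord0 (lift ord0 i) = p.2 ord0 i.
Proof. by have /= /rowP/(_ i) := congr1 snd (rV_consK p); rewrite mxE. Qed.

Lemma lebesgue_rVS m (A : set 'rV[R]_m.+1) :
  lebesgue_rV R m.+1 A = (lebesgue_measure \x lebesgue_rV R m)%E (@rV_cons R m @^-1` A).
Proof. by []. Qed.

Lemma lebesgue_measure_reflect (c : R) (A : set R) : measurable A ->
  lebesgue_measure ((fun t => c - t) @^-1` A) = lebesgue_measure A.
Proof.
move=> mA; have mf : measurable_fun setT (fun t : R => c - t : measurableTypeR R).
  exact: measurable_funB.
rewrite -[LHS]/(pushforward lebesgue_measure (fun t => c - t : measurableTypeR R) A).
apply/esym/(@lebesgue_measure_unique _ (pushforward lebesgue_measure (fun t => c - t : measurableTypeR R))) => //= _ [[a b]] _ <-.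
rewrite /pushforward.
have -> : (fun t => c - t) @^-1` `]a, b] = `[c - b, c - a[%classic.
  by apply/seteqP; split => t /=; rewrite !in_itv /= => /andP[? ?]; apply/andP; split; lra.
rewrite !lebesgue_measure_itv/= !lte_fin.
rewrite (_ : (c - b < c - a) = (a < b)); last by apply/idP/idP; lra.
by case: ifP => // _; congr (_%:E); ring.
Qed.

Lemma measurable_reflect_rV m (c : 'rV[R]_m) :
  measurable_fun setT (fun v : 'rV[R]_m => c - v).
Proof.
apply: measurable_to_rV => // i.
rewrite (_ : (fun x => _) = (fun x => c ord0 i - rV_coord i x)); last first.
  by apply/funext => x; rewrite !mxE.
by apply: measurable_funB => //; exact: measurable_rV_coord.
Qed.

(** Point reflections are handled coordinate by coordinate: a reflection of
    R^(m+1) is the product of a reflection of R and one of R^m, and a product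
    measure is determined by its values on rectangles. *)
Lemma lebesgue_rV_reflect m (c : 'rV[R]_m) (A : set 'rV[R]_m) : measurable A ->
  lebesgue_rV R m ((fun v => c - v) @^-1` A) = lebesgue_rV R m A.
Proof.
elim: m c A => [|m IH] c A mA.
  by congr (lebesgue_rV R 0 _); apply/seteqP; split => v /=; rewrite (thinmx0 v) (thinmx0 (_ - _)).
rewrite !lebesgue_rVS.
set f := fun p : R * 'rV[R]_m => ((c ord0 ord0 - p.1 : measurableTypeR R), (rV_uncons c).2 - p.2).
have mf : measurable_fun setT f.
  apply: measurable_fun_pair.
    by apply: measurable_funB => //; exact: measurable_fst.
  apply: (measurableT_comp (measurable_reflect_rV _)); exact: measurable_snd.
have fE : (fun v => c - v) \o @rV_cons R m = @rV_cons R m \o f.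
  apply/funext => p; rewrite /= -[LHS]rV_unconsK; congr rV_cons.
  apply: injective_projections; rewrite /=; first by rewrite mxE [X in _ + X]mxE rV_cons0.
  by apply/rowP => i; rewrite 3!mxE rV_consS !mxE.
rewrite -comp_preimage fE comp_preimage.
have mB : measurable (@rV_cons R m @^-1` A).
  by rewrite -[X in measurable X]setTI; exact: measurable_rV_cons.
move: (_ @^-1` A) mB => B mB.
rewrite -[LHS]/(pushforward (lebesgue_measure \x lebesgue_rV R m)%E f B).
apply/esym/(@product_measure_unique _ _ _ _ _ _ _ (pushforward (lebesgue_measure \x lebesgue_rV R m)%E f)) => // X Y mX mY.
transitivity ((lebesgue_measure \x lebesgue_rV R m)%E (((fun t => c ord0 ord0 - t) @^-1` X) `*` ((fun v => (rV_uncons c).2 - v) @^-1` Y))); first by [].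
rewrite product_measure1E //.
- by congr (_ * _)%E; [exact: lebesgue_measure_reflect|exact: IH].
- rewrite -[X in measurable X]setTI.
  by apply: (_ : measurable_fun setT (fun t : R => c ord0 ord0 - t)) => //; exact: measurable_funB.
- by rewrite -[X in measurable X]setTI; exact: measurable_reflect_rV.
Qed.

Definition cube m (c : 'rV[R]_m) (s : R) : set 'rV[R]_m :=
  [set v | forall i, `|v ord0 i - c ord0 i| <= s].

Lemma measurable_cube m (c : 'rV[R]_m) s : measurable (cube c s).
Proof.
rewrite (_ : cube c s = \bigcap_(i in [set: 'I_m]) (rV_coord i @^-1` `[c ord0 i - s, c ord0 i + s])).
  apply: fin_bigcap_measurable => // i _; rewrite -[X in measurable X]setTI.
  by apply: measurable_rV_coord.
apply/seteqP; split => v /= vc i; rewrite /= ?in_itv/=.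
  by move=> _; rewrite /rV_coord; have := vc i; rewrite ler_distl.
by have := vc i Logic.I; rewrite /= in_itv/= ler_distl.
Qed.

Lemma lebesgue_cube m (c : 'rV[R]_m) s : 0 <= s ->
  lebesgue_rV R m (cube c s) = ((2 * s) ^+ m)%:E.
Proof.
move=> s0; elim: m c => [|m IH] c.
  by rewrite /= /dirac expr0 indicE mem_set // => -[].
rewrite lebesgue_rVS.
have -> : @rV_cons R m @^-1` cube c s = `[c ord0 ord0 - s, c ord0 ord0 + s] `*` cube (rV_uncons c).2 s.
  apply/seteqP; split => p /=.
    move=> H; split; rewrite /= ?in_itv/=.
      by have := H ord0; rewrite rV_cons0 ler_distl.
    by move=> i; have := H (lift ord0 i); rewrite rV_consS mxE.
  rewrite in_itv /= -ler_distl => -[H0 H] i.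
  case: (unliftP ord0 i) => [j ->|->]; last by rewrite rV_cons0.
  by rewrite rV_consS; have := H j; rewrite mxE.
rewrite product_measure1E //; last exact: measurable_cube.
rewrite IH [X in (X * _)%E](_ : _ = lebesgue_measure `[c ord0 ord0 - s, c ord0 ord0 + s]%classic) // lebesgue_measure_itv/= lte_fin.
case: ifPn => [_|H]; first by rewrite -EFinM exprS; congr (_%:E); ring.
have -> : s = 0 by lra.
by rewrite mulr0 exprS mul0r mul0e.
Qed.

Lemma rV_ballE m (c v : 'rV[R]_m) e :
  ball c e v <-> 0 < e /\ forall i, `|c ord0 i - v ord0 i| < e.
Proof.
split => -[e0 H]; split => //.
  by move=> i; exact: (H ord0 i).
by move=> i j; rewrite (ord1 i); exact: (H j).
Qed.

(** The sigma-algebra is generated by the coordinates, so an open set has to be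
    written as a countable union of boxes, here cubes with rational centres. *)
Lemma open_measurable_rV m (U : set 'rV[R]_m) : open U -> measurable U.
Proof.
move=> oU.
pose q (x : 'rV[rat]_m) : 'rV[R]_m := map_mx ratr x.
pose F (p : 'rV[rat]_m * nat) : set 'rV[R]_m :=
  if `[< cube (q p.1) p.2.+1%:R^-1 `<=` U >] then cube (q p.1) p.2.+1%:R^-1 else set0.
rewrite (_ : U = \bigcup_(p in [set: 'rV[rat]_m * nat]) F p).
  apply: countable_bigcupT_measurable => //.
  by move=> p; rewrite /F; case: asboolP => //= H; exact: measurable_cube.
apply/seteqP; split => [v Uv|v [p _]]; last by rewrite /F; case: asboolP => // H; exact: H.
have /nbhs_ballP[e /= e0 eU] := oU v Uv.
(* cubes of half-side 1/(k+1) < e/2 around points 1/(k+1)-close to v stay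
   inside the ball of radius e *)
pose k := Num.truncn (2 / e).
have ke : k.+1%:R^-1 < e / 2.
  rewrite -ltf_pV2 ?posrE ?divr_gt0 ?invr_gt0// invrK invf_div.
  exact: truncnS_gt.
have k0 : 0 < k.+1%:R^-1 :> R by rewrite invr_gt0.
have /choice[x hx] : forall i, exists r : rat, ratr r \in `]v ord0 i - k.+1%:R^-1, v ord0 i + k.+1%:R^-1[.
  by move=> i; apply: rat_in_itvoo; rewrite ltrD2l (lt_trans _ k0) ?oppr_lt0.
have xv i : `|v ord0 i - ratr (x i)| < k.+1%:R^-1.
  by have := hx i; rewrite in_itv/= distrC ltr_distl.
exists (\row_i x i, k) => //; rewrite /F /=; case: asboolP => [_|[]].
  by move=> i; rewrite !mxE ltW.
move=> w wx; apply: eU; apply/rV_ballE; split => // i.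
have := wx i; rewrite !mxE => wxi.
rewrite (le_lt_trans (ler_distD (ratr (x i)) _ _))// [e]splitr ltrD//.
  exact: lt_trans ke.
by rewrite distrC (le_lt_trans wxi).
Qed.

End rV_measure.

(** * Hyperplanes are null *)

Section hyperplane.
Context (R : realType).

Lemma measurable_dot m (u : 'rV[R]_m) : measurable_fun setT (dot u).
Proof.
rewrite (_ : dot u = fun v => \sum_i u ord0 i * v ord0 i) //.
apply: (@measurable_sum _ 'rV[R]_m R setT _ _ (fun i v => u ord0 i * v ord0 i)) => i.
by apply: measurable_funM => //; exact: (measurable_rV_coord i).
Qed.

Lemma measurable_hyperplane m (u : 'rV[R]_m) b : measurable [set v | dot u v = b].
Proof.
rewrite -[X in measurable X]setTI.
exact: (measurable_dot u measurableT (measurable_set1 b)).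
Qed.

(** By Fubini: if the first coefficient of [u] vanishes, every slice with fixed
    first coordinate is a hyperplane of R^m; otherwise every slice in the first
    direction is a single point. *)
Lemma lebesgue_hyperplane m (u : 'rV[R]_m) b : u != 0 ->
  lebesgue_rV R m [set v | dot u v = b] = 0%E.
Proof.
elim: m u b => [|m IH] u b u0; first by rewrite (thinmx0 u) eqxx in u0.
set H := [set v | _]; have mH : measurable H := measurable_hyperplane u b.
have mH' : measurable (@rV_cons R m @^-1` H).
  by rewrite -[X in measurable X]setTI; exact: measurable_rV_cons.
have HE p : (@rV_cons R m @^-1` H) p <-> u ord0 ord0 * p.1 + dot (rV_uncons u).2 p.2 = b.
  rewrite /H /= /dot big_ord_recl rV_cons0.
  under eq_bigr do rewrite rV_consS.
  by under [in X in _ <-> X]eq_bigr do rewrite mxE.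
rewrite lebesgue_rVS; have [u00|u00] := eqVneq (u ord0 ord0) 0.
  have u'0 : (rV_uncons u).2 != 0.
    apply: contraNN u0 => /eqP u'0; apply/eqP/rowP => i; rewrite mxE.
    case: (unliftP ord0 i) => [j ->|->//].
    by have /rowP/(_ j) := u'0; rewrite !mxE.
  rewrite /product_measure1 (eq_integral (cst 0%E)) ?integral0 // => x _ /=.
  rewrite -(IH _ b u'0); congr (lebesgue_rV R m _).
  apply/seteqP; split => v /=; rewrite /xsection /=.
    by rewrite inE => /HE; rewrite u00 mul0r add0r.
  by rewrite inE => E; apply/HE; rewrite u00 mul0r add0r.
rewrite (@product_measure_unique _ _ _ _ _ _ _ (lebesgue_measure \x^ lebesgue_rV R m)%E) //; last first.
  by move=> A B mA mB; exact: product_measure2E.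
transitivity (\int[lebesgue_rV R m]_v lebesgue_measure (ysection (@rV_cons R m @^-1` H) v))%E; first by [].
rewrite (eq_integral (cst 0%E)) ?integral0 // => v _ /=.
rewrite -(lebesgue_measure_set1 ((b - dot (rV_uncons u).2 v) / u ord0 ord0)).
congr (lebesgue_measure _).
apply/seteqP; split => x /=; rewrite /ysection /=.
  by rewrite inE => /HE /= <-; rewrite addrK mulrC mulKf.
by move=> ->; rewrite inE; apply/HE; rewrite /= mulrC divfK // subrK.
Qed.

End hyperplane.

(** * Integrability of the kernel away from its pole *)

Section annuli.
Context (R : realType) (m : nat) (alpha : R).
Hypothesis alpha0 : 0 < alpha.
Local Notation E := 'rV[R]_m.

Lemma measurable_enorm (x : E) : measurable_fun setT (fun y : E => enorm (y - x)).
Proof.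
apply: (@measurableT_comp _ _ _ _ _ _ (@Num.sqrt R)).
  exact: continuous_measurable_fun (@sqrt_continuous R).
apply: (@measurable_sum _ 'rV[R]_m R setT _ _ (fun i y => (y - x) ord0 i ^+ 2)) => i.
apply: measurable_funX.
rewrite (_ : (fun y => _) = (fun y => rV_coord i y - x ord0 i)); last by apply/funext => y; rewrite !mxE.
by apply: measurable_funB => //; exact: measurable_rV_coord.
Qed.

Definition kernel (x y : E) : R := (enorm (y - x) `^ (m%:R + alpha))^-1.

Lemma kernel_ge0 x y : 0 <= kernel x y.
Proof. by rewrite invr_ge0 powR_ge0. Qed.

Definition far (x : E) (eps : R) : set E := [set y | eps <= enorm (y - x)].

Lemma measurable_far x eps : measurable (far x eps).
Proof.
rewrite (_ : far x eps = setT `&` (fun y => enorm (y - x)) @^-1` `[eps, +oo[).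
  by apply: measurable_enorm.
by rewrite setTI; apply/seteqP; split => y /=; rewrite in_itv /= andbT.
Qed.

Lemma measurable_kernel x : measurable_fun setT (kernel x).
Proof.
rewrite (_ : kernel x = (@powR R)^~ (- (m%:R + alpha)) \o (fun y => enorm (y - x))).
  by apply: measurableT_comp; [exact: measurable_powR|exact: measurable_enorm].
by apply/funext => y; rewrite /= powRN.
Qed.

(** Dyadic annuli: on the k-th one the kernel is about (eps 2^k)^-(m+alpha), on a
    volume about (eps 2^k)^m, so that its integrals form a geometric series of
    ratio 2^-alpha. *)
Definition annulus (x : E) (eps : R) k := [set y : E | eps * 2 ^+ k <= enorm (y - x) < eps * 2 ^+ k.+1].

Lemma measurable_annulus x eps k : measurable (annulus x eps k).
Proof.
rewrite (_ : annulus x eps k = setT `&` (fun y => enorm (y - x)) @^-1` `[eps * 2 ^+ k, eps * 2 ^+ k.+1[).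
  by apply: measurable_enorm.
by rewrite setTI; apply/seteqP; split => y /=; rewrite in_itv.
Qed.

Lemma trivIset_annulus x eps : 0 < eps -> trivIset setT (annulus x eps).
Proof.
move=> e0; suff H i j : (i < j)%N -> annulus x eps i `&` annulus x eps j = set0.
  apply/trivIsetP => i j _ _; case: (ltngtP i j) => // ij _; first exact: H.
  by rewrite setIC; exact: H.
move=> ij; apply/seteqP; split => // y /= [/andP[_ yi] /andP[yj _]].
have : eps * 2 ^+ j < eps * 2 ^+ i.+1 by exact: le_lt_trans yi.
by rewrite ltr_pM2l // ltr_eXn2l ?ltr1n // ltnNge ij.
Qed.

Lemma far_bigcup_annulus x eps : 0 < eps -> far x eps = \bigcup_k annulus x eps k.
Proof.
move=> e0; apply/seteqP; split => y /=; last first.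
  move=> [k _ /andP[+ _]]; apply: le_trans.
  by rewrite ler_peMr ?(ltW e0) // exprn_ege1 // ler1n.
move=> ey; have [n0 yn0] : exists n, enorm (y - x) < eps * 2 ^+ n.+1.
  exists (Num.truncn (enorm (y - x) / eps)); rewrite mulrC -ltr_pdivrMr //.
  apply: (lt_le_trans (truncnS_gt _)); rewrite -natrX ler_nat.
  exact/ltnW/ltn_expl.
case: (@ex_minnP (fun n => enorm (y - x) < eps * 2 ^+ n.+1) (ex_intro _ n0 yn0)) => k yk kmin; exists k => //.
rewrite /annulus /= yk andbT; case: k yk kmin => [|k] yk kmin; first by rewrite expr0 mulr1.
by rewrite leNgt; apply/negP => /kmin; rewrite ltnn.
Qed.

Lemma integral_annulus_le x eps k : 0 < eps ->
  (\int[lebesgue_rV R m]_(y in annulus x eps k) (kernel x y)%:E <=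
   ((4 ^+ m / eps `^ alpha) * (2 `^ (- alpha)) ^+ k)%:E)%E.
Proof.
move=> e0; set r := eps * 2 ^+ k.
have r0 : 0 < r by rewrite mulr_gt0 ?exprn_gt0.
have mA := measurable_annulus x eps k.
apply: (@le_trans _ _ (\int[lebesgue_rV R m]_(y in annulus x eps k) (cst ((r `^ (m%:R + alpha))^-1)%:E y))%E).
  apply: ge0_le_integral => //.
  - by move=> y _; rewrite lee_fin kernel_ge0.
  - apply/measurable_EFinP; exact: measurable_funTS (measurable_kernel x).
  - move=> y /andP[yr _]; rewrite lee_fin lef_pV2 ?posrE ?powR_gt0 //; last exact: lt_le_trans yr.
    by rewrite ge0_ler_powR ?nnegrE ?enorm_ge0 ?(ltW r0) // addr_ge0 ?(ltW alpha0).
rewrite integral_cst //.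
apply: (@le_trans _ _ (((r `^ (m%:R + alpha))^-1)%:E * ((2 * (r * 2)) ^+ m)%:E)%E).
  rewrite lee_wpmul2l ?lee_fin ?invr_ge0 ?powR_ge0 //.
  have r2 : 0 <= r * 2 by rewrite mulr_ge0 // ltW.
  rewrite -(lebesgue_cube x r2); apply: le_measure; rewrite ?inE //.
    exact: measurable_cube.
  move=> y /andP[_ yr] i; have := coord_le_enorm (y - x) i; rewrite !mxE => /le_trans -> //.
  by rewrite (le_trans (ltW yr)) // exprSr mulrA.
rewrite -EFinM lee_fin powRD; last by apply/implyP => _; rewrite gt_eqF.
rewrite powR_mulrn ?(ltW r0) // {2}/r powRM ?exprn_ge0 ?(ltW e0) //.
have -> : (2 ^+ k) `^ alpha = (2 `^ alpha) ^+ k :> R.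
  by rewrite -powR_mulrn // -powRrM mulrC powRrM powR_mulrn ?powR_ge0.
rewrite (_ : 2 * (r * 2) = r * 4); last by ring.
rewrite powRN exprVn [(r * 4) ^+ m]exprMn.
have A0 : r ^+ m != 0 by rewrite expf_neq0 ?gt_eqF.
have P0 : eps `^ alpha != 0 by rewrite gt_eqF ?powR_gt0.
have Q0 : (2 `^ alpha) ^+ k != 0 :> R by rewrite expf_neq0 ?gt_eqF ?powR_gt0.
rewrite [leLHS](_ : _ = 4 ^+ m / eps `^ alpha / (2 `^ alpha) ^+ k) //.
move: (r ^+ m) (4 ^+ m : R) (eps `^ alpha) ((2 `^ alpha) ^+ k) A0 P0 Q0 => A B P Q A0 P0 Q0.
by field; rewrite A0 P0 Q0.
Qed.

Lemma kernel_integrable x eps : 0 < eps ->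
  (lebesgue_rV R m).-integrable (far x eps) (EFin \o kernel x).
Proof.
move=> e0; have mK D : measurable_fun D (EFin \o kernel x).
  by apply/measurable_EFinP; exact: measurable_funTS (measurable_kernel x).
apply/integrableP; split => //.
under eq_integral do rewrite /= ger0_norm ?kernel_ge0//.
rewrite far_bigcup_annulus // ge0_integral_bigcup //; last 3 first.
- exact: measurable_annulus.
- by move=> y _; rewrite lee_fin kernel_ge0.
- exact: trivIset_annulus.
set a := 4 ^+ m / eps `^ alpha; set q := 2 `^ (- alpha).
apply: (@le_lt_trans _ _ (\sum_(0 <= k <oo) (a * q ^+ k)%:E)%E).
  apply: lee_nneseries => [k _ _|k _]; last exact: integral_annulus_le.
  by apply: integral_ge0 => y _; rewrite lee_fin kernel_ge0.
have q1 : `|q| < 1.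
  rewrite ger0_norm ?powR_ge0 // /q powRN invf_lt1 ?powR_gt0 //.
  by have := @gt0_ltr_powR _ alpha alpha0 1 2; rewrite powR1 !nnegrE ltr1n; exact.
apply: (@le_lt_trans _ _ (a / (1 - q))%:E); last exact: ltry.
have a0 : 0 <= a by rewrite divr_ge0 ?exprn_ge0 ?powR_ge0.
have q0 : 0 < q by rewrite powR_gt0.
apply: lime_le; first by apply: is_cvg_nneseries => k _ _; rewrite lee_fin mulr_ge0 // exprn_ge0 ?ltW.
by apply: nearW => k; rewrite sumEFin lee_fin; have := geometric_le_lim k a0 q0 q1.
Qed.

End annuli.

(** * Curvature of a set contained in a slab *)

Section truncated_bound.
Context (R : realType) (m : nat) (alpha : R).
Hypothesis alpha0 : 0 < alpha.
Local Notation E := 'rV[R]_m.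
Local Notation mu := (lebesgue_rV R m).

Definition indic_sign (A : set E) (y : E) : R := \1_(~` A) y - \1_A y.

Lemma indic_signE (A : set E) y : indic_sign A y = if y \in A then -1 else 1.
Proof. by rewrite /indic_sign !indicE in_setC; case: (y \in A) => /=; rewrite ?sub0r ?subr0. Qed.

Lemma measurable_indic_sign (A : set E) : measurable A -> measurable_fun setT (indic_sign A).
Proof.
move=> mA; apply: measurable_funB; apply: measurable_indic => //; exact: measurableC.
Qed.

Lemma ge0_integral_reflect (c : E) (D : set E) (f : E -> \bar R) : measurable D ->
  measurable_fun D f -> (forall y, D y -> (0 <= f y)%E) ->
  (\int[mu]_(y in D) f y = \int[mu]_(y in (fun y => (c - y)%R) @^-1` D) f (c - y)%R)%E.
Proof.
move=> mD mf f0.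
rewrite -[RHS](ge0_integral_pushforward (measurable_reflect_rV c)) //; last first.
  by move=> y /[!inE]; exact: f0.
apply: eq_measure_integral; first exact: measurable_reflect_rV.
move=> mr A mA _.
exact: (esym (lebesgue_rV_reflect c mA)).
Qed.

(** The volume of a cube of half-side [W] times a lower bound for the
    kernel on that cube, when the cube is placed as in [far_cube].  It scales as
    [W `^ (- alpha)]. *)
Definition slab_bound (W : R) : R :=
  (2 * W) ^+ m * ((m%:R * ((m%:R + 3) * W)) `^ (m%:R + alpha))^-1.

Lemma slab_bound_gt0 W : (0 < m)%N -> 0 < W -> 0 < slab_bound W.
Proof.
move=> m0 W0; have mR : 0 < m%:R :> R by rewrite ltr0n.
apply: mulr_gt0; first by apply: exprn_gt0; exact: mulr_gt0.
by rewrite invr_gt0; apply: powR_gt0; rewrite !mulr_gt0 // addr_gt0.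
Qed.

Lemma slab_boundE W : (0 < m)%N -> 0 < W -> slab_bound W = slab_bound 1 / W `^ alpha.
Proof.
move=> m0 W0; have mR : 0 < m%:R :> R by rewrite ltr0n.
have b0 : 0 < m%:R * (m%:R + 3) :> R by rewrite mulr_gt0 // addr_gt0.
have Wa : W `^ (m%:R + alpha) = W ^+ m * W `^ alpha.
  by rewrite powRD ?powR_mulrn ?(ltW W0) //; apply/implyP => _; rewrite gt_eqF.
rewrite /slab_bound !mulr1 mulrA powRM ?(ltW W0) ?(ltW b0) // Wa exprMn.
have B0 : (m%:R * (m%:R + 3)) `^ (m%:R + alpha) != 0 :> R by rewrite gt_eqF // powR_gt0.
have P0 : W ^+ m != 0 by rewrite expf_neq0 // gt_eqF.
have Q0 : W `^ alpha != 0 by rewrite gt_eqF // powR_gt0.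
move: (_ `^ _) (W ^+ m) (W `^ alpha) (2 ^+ m) B0 P0 Q0 => B P Q C B0 P0 Q0.
by field; rewrite B0 P0 Q0.
Qed.

Lemma far_reflect (x : E) eps : (fun y => (x + x) - y) @^-1` far x eps = far x eps.
Proof.
apply/seteqP; split => y; rewrite /far /=.
  by rewrite -enormN (_ : - (x + x - y - x) = y - x) // addrAC addrK opprB.
by rewrite -enormN (_ : - (y - x) = x + x - y - x) // addrAC addrK opprB.
Qed.

Lemma kernel_reflect (x y : E) : kernel alpha x (x + x - y) = kernel alpha x y.
Proof.
by rewrite /kernel -enormN (_ : - (x + x - y - x) = y - x) // addrAC addrK opprB.
Qed.

Lemma signed_kernel_integrable (A : set E) x eps : 0 < eps -> measurable A ->
  mu.-integrable (far x eps) (EFin \o (fun y => indic_sign A y * kernel alpha x y)).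
Proof.
move=> e0 mA; apply: (@le_integrable _ _ _ _ _ _ _ (EFin \o kernel alpha x)).
- exact: measurable_far.
- apply/measurable_EFinP; apply: measurable_funTS; apply: measurable_funM.
    exact: measurable_indic_sign.
  exact: measurable_kernel.
- move=> y _; rewrite /= lee_fin normrM indic_signE.
  by case: ifP; rewrite ?normrN normr1 mul1r.
- exact: kernel_integrable.
Qed.

Lemma Rintegral_reflect (c : E) (D : set E) (f : E -> R) : measurable D ->
  measurable_fun setT f -> mu.-integrable D (EFin \o f) ->
  mu.-integrable ((fun y => c - y) @^-1` D) (fun y => (f (c - y))%:E) /\
  \int[mu]_(y in (fun y => c - y) @^-1` D) f (c - y) = \int[mu]_(y in D) f y.
Proof.
move=> mD mf intf.
have mr := measurable_reflect_rV c.
have intr : mu.-integrable ((fun y => c - y) @^-1` D) (fun y => (f (c - y))%:E).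
  apply/integrableP; split.
    apply/measurable_EFinP; apply: measurable_funTS.
    exact: (measurableT_comp mf mr).
  move/integrableP : intf => [mfD]; rewrite (ge0_integral_reflect c) //.
  by apply: measurableT_comp.
split => //; rewrite /Rintegral; congr fine.
rewrite -(integral_pushforward mr (f := EFin \o f)) //; last exact/measurable_EFinP.
by apply: eq_measure_integral => //= A mA _; exact: lebesgue_rV_reflect.
Qed.

(** The cube is centred at distance (m+2) W from [x]: as <., e> differs by at
    most m W from its value at the centre, the cube stays beyond the slab of thickness [W] that touches [x], and
    its points are at distance at most m (m+3) W from [x]. *)
Lemma far_cube (e x y : E) (W : R) : dot e e = 1 -> 0 < W ->
  cube (x + ((m%:R + 2) * W) *: e) W y ->
  dot e x + W < dot e y /\
  ((m%:R * ((m%:R + 3) * W)) `^ (m%:R + alpha))^-1 <= kernel alpha x y.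
Proof.
move=> e1 W0 Qy.
have [z [yE zb]] : exists z, y = x + (((m%:R + 2) * W) *: e + z) /\ forall i, `|z ord0 i| <= W.
  exists (y - (x + ((m%:R + 2) * W) *: e)); split; first by rewrite addrA addrC subrK.
  by move=> i; have := Qy i; rewrite !mxE.
have yx : dot e x + W < dot e y.
  have := dot_le_coord e1 zb; rewrite yE !dotDr dotZr e1 mulr1 ltrD2l mulrDl.
  move: (dot e z) (m%:R * W) => t s; rewrite ler_norml => /andP[+ _].
  by clear -W0; lra.
split; first exact: yx.
have yb i : `|(y - x) ord0 i| <= (m%:R + 3) * W.
  rewrite yE addrC addKr !mxE; apply: (le_trans (ler_normD _ _)); rewrite normrM.
  have W2 : 0 <= (m%:R + 2) * W by apply: mulr_ge0; [exact: addr_ge0|exact: ltW].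
  rewrite (ger0_norm W2); apply: (@le_trans _ _ ((m%:R + 2) * W * 1 + W)).
    by apply: lerD; [apply: ler_wpM2l; [exact: W2|exact: unit_coord_le1]|exact: zb].
  by rewrite mulr1 !mulrDl; clear -W0; lra.
have xy0 : 0 < enorm (y - x).
  apply: (lt_le_trans _ (dot_le_enorm _ e1)); apply: (lt_le_trans _ (ler_norm _)); rewrite dotBr.
  by move: (dot e y) (dot e x) yx => s t; clear -W0; lra.
have le1 := enorm_le_coord yb.
have b0 := lt_le_trans xy0 le1.
rewrite /kernel lef_pV2 ?posrE; last 2 first.
- exact: powR_gt0.
- exact: powR_gt0.
apply: ge0_ler_powR; rewrite ?nnegrE; first by rewrite addr_ge0 ?(ltW alpha0).
- exact: ltW.
- exact: ltW.
- exact: le1.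
Qed.

(** Averaging an integral with its reflection.  A null set [Z] is removed on the
    right because the symmetrised integrand will only be controlled off a
    hyperplane. *)
Lemma Rintegral_symmetrize (c : E) (D Z : set E) (f : E -> R) : measurable D ->
  measurable_fun setT f -> mu.-integrable D (EFin \o f) ->
  (fun y => c - y) @^-1` D = D -> measurable Z -> mu Z = 0%E ->
  mu.-integrable (D `\` Z) (EFin \o (fun y => f y + f (c - y))) /\
  ((2 * \int[mu]_(y in D) f y)%:E =
    \int[mu]_(y in D `\` Z) (f y + f (c - y))%:E)%E.
Proof.
move=> mD mf intf Dc mZ Z0.
have [intr Er] := Rintegral_reflect c mD mf intf.
rewrite Dc in intr Er.
have inth : mu.-integrable D (EFin \o (fun y => f y + f (c - y))) by exact: (integrableD mD intf intr).
split; first by apply: integrableS inth => //; exact: measurableD.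
rewrite mulr_natl mulr2n -[X in (_ + X)%:E]Er -RintegralD //.
by rewrite /Rintegral fineK ?integrable_fin_num // (negligible_integral mZ).
Qed.

(** Of two points symmetric about [x] and off the hyperplane <., e> = <x, e>, one
    lies on the outer side of [x], hence outside [A]; so the contributions of
    the pair to the integral never add up to a negative number.  When both
    points lie outside the slab, as for the cube of [far_cube], the two
    contributions are positive.  The bound does not depend on the truncation
    radius, and so passes to the principal value. *)
Lemma truncated_slab_bound (A : set E) (e x : E) W eps :
  measurable A -> dot e e = 1 -> 0 < eps -> eps <= W ->
  (forall y, A y -> dot e x - W <= dot e y <= dot e x) ->
  slab_bound W <= \int[mu]_(y in far x eps) (indic_sign A y * kernel alpha x y).
Proof.
move=> mA e1 eps0 epsW Aslab; have W0 : 0 < W by exact: lt_le_trans epsW.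
set D := far x eps; have mD : measurable D by exact: measurable_far.
pose f y := indic_sign A y * kernel alpha x y.
have mf : measurable_fun setT f.
  by apply: measurable_funM; [exact: measurable_indic_sign|exact: measurable_kernel].
have intf : mu.-integrable D (EFin \o f) by exact: signed_kernel_integrable.
pose K0 := ((m%:R * ((m%:R + 3) * W)) `^ (m%:R + alpha))^-1.
pose Q := cube (x + ((m%:R + 2) * W) *: e) W.
have mQ : measurable Q by exact: measurable_cube.
pose Z := [set y | dot e y = dot e x].
have mZ : measurable Z by exact: measurable_hyperplane.
have Z0 : mu Z = 0%E.
  by apply: lebesgue_hyperplane; apply: contra_eqN e1 => /eqP ->; rewrite -(scale0r 0) dotZl mul0r eq_sym oner_eq0.
have QP y : Q y -> dot e x + W < dot e y /\ K0 <= kernel alpha x y.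
  exact: far_cube.
have QD : Q `<=` D `\` Z.
  move=> y /QP[yM _]; split; last by rewrite /Z /= => yZ; move: yM; rewrite yZ -ltrBrDl subrr ltNge ltW.
  rewrite /D /far /=; apply: (le_trans epsW); apply: (le_trans _ (dot_le_enorm _ e1)).
  by apply: (le_trans _ (ler_norm _)); rewrite dotBr lerBrDl ltW.
pose h y := f y + f (x + x - y).
have [inthZ twoI] := Rintegral_symmetrize mD mf intf (far_reflect x eps) mZ Z0.
rewrite -/h in inthZ.
have h0 y : ~ Z y -> 0 <= h y.
  move=> Zy; rewrite /h /f kernel_reflect -mulrDl mulr_ge0 ?kernel_ge0 //.
  rewrite !indic_signE; case: ifPn => [|_]; case: ifPn => [|_]; rewrite ?inE.
  - move=> /Aslab/andP[h1 h2] /Aslab/andP[_ h3]; exfalso; apply: Zy.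
    move: h2 h3; rewrite dotBr dotDr /Z /=; move: (dot e x) (dot e y) => s t.
    by clear; lra.
  - by rewrite addNr.
  - by rewrite subrr.
  - by rewrite addr_ge0.
have hQ y : Q y -> 2 * K0 <= h y.
  move=> /QP[yM yK]; rewrite /h /f kernel_reflect -mulrDl !indic_signE.
  have -> : y \in A = false.
    apply/negbTE/negP; rewrite inE => /Aslab/andP[_]; move: yM; move: (dot e x) (dot e y) => s t.
    by clear -W0; lra.
  have -> : (x + x - y) \in A = false.
    apply/negbTE/negP; rewrite inE => /Aslab/andP[+ _]; move: yM; rewrite dotBr dotDr; move: (dot e x) (dot e y) => s t.
    by clear -W0; lra.
  by rewrite (_ : 1 + 1 = 2) // ler_wpM2l.
have mh : measurable_fun (D `\` Z) (EFin \o h) by case/integrableP : inthZ.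
clear inthZ intf mf.
rewrite -(@ler_pM2l _ 2) // -lee_fin twoI.
change ((2 * slab_bound W)%:E <= \int[mu]_(y in D `\` Z) (h y)%:E)%E.
clear twoI; clearbody f.
apply: (@le_trans _ _ (\int[mu]_(y in Q) (cst (2 * K0)%:E y))%E).
  rewrite integral_cst // [X in (_ <= _ * X)%E](_ : _ = ((2 * W) ^+ m)%:E); last exact: lebesgue_cube (ltW W0).
  rewrite -EFinM lee_fin le_eqVlt; apply/orP; left; apply/eqP.
  by rewrite /slab_bound -/K0 -mulrA (mulrC K0).
apply: (@le_trans _ _ (\int[mu]_(y in Q) (h y)%:E)%E).
  apply: ge0_le_integral => //.
  - by move=> y _; rewrite lee_fin mulr_ge0 ?invr_ge0 ?powR_ge0.
  - by apply: measurable_funS mh => //; exact: measurableD.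
apply: ge0_subset_integral => //; first exact: measurableD.
by move=> y [_ Zy]; rewrite lee_fin h0.
Qed.

End truncated_bound.

(** * Which side of its boundary a set occupies *)

Section separation.
Context (R : realType) (m : nat).
Local Notation E := 'rV[R]_m.

Lemma dot_continuous (u : E) : continuous (dot u).
Proof.
suff H (r : seq 'I_m) : continuous (fun v : E => \sum_(i <- r) u ord0 i * v ord0 i) by exact: H.
elim: r => [|i r IH] v.
  have -> : (fun v : E => \sum_(i <- [::]) u ord0 i * v ord0 i) = cst 0.
    by apply/funext => w; rewrite big_nil.
  exact: cst_continuous.
have -> : (fun v : E => \sum_(j <- i :: r) u ord0 j * v ord0 j) =
    (fun v : E => u ord0 i * v ord0 i) + (fun v : E => \sum_(j <- r) u ord0 j * v ord0 j).
  by apply/funext => w; rewrite big_cons.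
have := @IH v; apply: continuousD.
apply: (@continuousM R E (cst (u ord0 i)) (fun v => v ord0 i)).
  exact: cst_continuous.
exact: coord_continuous.
Qed.

(** A segment is connected, and an open set is closed relative to any set that
    misses its boundary. *)
Lemma segment_in_open (Omega : set E) (p q : E) : open Omega ->
  (forall s, 0 <= s <= 1 -> ~ boundary Omega (p + s *: (q - p))) ->
  Omega p -> Omega q.
Proof.
move=> oO nb Op; set c := fun s : R => p + s *: (q - p).
have cc : continuous c.
  by move=> s; apply: cvgD; [exact: cvg_cst|apply: cvgZr_tmp; exact: cvg_id].
have conn := connected_continuous_connected (@segment_connected R 0 1) (continuous_subspaceT cc).
have c0 : c 0 = p by rewrite /c scale0r addr0.
have c1 : c 1 = q by rewrite /c scale1r addrC subrK.
have E1 : (c @` `[0, 1]) `&` Omega = c @` `[0, 1].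
  apply: conn.
  - by exists p; split => //; exists 0 => //=; rewrite in_itv /= lexx ler01.
  - by exists Omega.
  - exists (closure Omega); first exact: closed_closure.
    apply/seteqP; split => y [[s s01 sy]] Oy; split; try by exists s.
      exact: subset_closure.
    apply: contrapT => nO; apply: (nb s); first by move: s01; rewrite /= in_itv.
    have -> : p + s *: (q - p) = y by [].
    by split => //; rewrite (interior_id Omega).1.
have : (c @` `[0, 1]) q by exists 1 => //=; rewrite in_itv /= ler01 lexx.
by rewrite -E1 => -[].
Qed.

End separation.

Section slab_sides.
Context (R : realType) (n : nat).
Hypothesis n1 : (1 <= n)%N.
Local Notation E := 'rV[R]_n.+1.

(** Dimension at least two enters here: on a line, the two sides of a
    slab could not be joined around it. *)
Lemma exists_orthogonal (e : E) : exists2 f : E, 0 < dot f f & dot e f = 0.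
Proof.
have dotE (u : E) i : dot u (delta_mx ord0 i) = u ord0 i.
  rewrite /dot (bigD1 i) //= big1 ?addr0 ?mxE ?eqxx ?mulr1 //.
  by move=> j /negbTE ji; rewrite mxE ji andbF mulr0.
have i01 : ord0 != ord_max :> 'I_n.+1 by rewrite -val_eqE /= eq_sym -lt0n.
have pos (f : E) i : f ord0 i != 0 -> 0 < dot f f.
  by move=> fi; rewrite lt_neqAle dotvv_ge0 andbT eq_sym; apply: contraNN fi => /eqP/dotvv_eq0 ->; rewrite mxE.
have [e0|e0] := eqVneq (e ord0 ord0) 0.
  exists (delta_mx ord0 ord0); last by rewrite dotE.
  by apply: (pos _ ord0); rewrite mxE eqxx oner_neq0.
exists (e ord0 ord_max *: delta_mx ord0 ord0 - e ord0 ord0 *: delta_mx ord0 ord_max).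
  apply: (pos _ ord_max); rewrite !mxE !eqxx /= (negbTE (_ : ord_max != ord0 :> 'I_n.+1)); last by rewrite eq_sym.
  by rewrite mulr0 mulr1 sub0r oppr_eq0.
by rewrite dotBr !dotZr !dotE mulrC subrr.
Qed.

(** Two points outside the slab are joined, far away from the bounded boundary,
    by a path made of two segments parallel to the slab and one segment far out
    in the direction [f].  Hence either all points outside the slab belong to
    [Omega], or none does. *)
Lemma slab_sides (Omega : set E) (e : E) a b : open Omega -> bounded_set (boundary Omega) ->
  (forall y, boundary Omega y -> a <= dot e y <= b) ->
  (forall y, Omega y -> a <= dot e y <= b) \/
  (forall y, ~ Omega y -> a <= dot e y <= b).
Proof.
move=> oO [L [_ bL]] slab.
have [f f0 ef] := exists_orthogonal e.
have {bL} [M fM] : exists M, forall y, boundary Omega y -> dot f y <= M.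
  exists (\sum_i `|f ord0 i| * (L + 1)) => y By.
  have yL : `|y| <= L + 1 by apply: (bL (L + 1)) => //; rewrite ltrDl.
  apply: ler_sum => i _; apply: (le_trans (ler_norm _)); rewrite normrM ler_wpM2l //.
  exact: le_trans (rV_norm_coord _ _) yL.
have same p q : ~~ (a <= dot e p <= b) -> ~~ (a <= dot e q <= b) -> Omega p -> Omega q.
  move=> pab qab Op.
  have [s [s0 ps qs]] : exists s, [/\ 0 <= s, M < dot f (p + s *: f) & M < dot f (q + s *: f)].
    (* moving both points by s f brings them beyond the level M of <., f> *)
    pose N := `|M| + `|dot f p| + `|dot f q| + 1.
    have N0 : 0 <= N by rewrite !addr_ge0.
    exists (N / dot f f).
    split; first by rewrite divr_ge0 // ltW.
      rewrite dotDr dotZr divfK ?gt_eqF // /N.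
      have := ler_norm M; have := ler_norm (- dot f p); rewrite normrN; have := normr_ge0 (dot f q).
      by move: (dot f p) (dot f q) `|_| `|_| `|_| => x y u v w; lra.
    rewrite dotDr dotZr divfK ?gt_eqF // /N.
    have := ler_norm M; have := ler_norm (- dot f q); rewrite normrN; have := normr_ge0 (dot f p).
    by move: (dot f p) (dot f q) `|_| `|_| `|_| => x y u v w; lra.
  have vert x r : ~~ (a <= dot e x <= b) -> ~ boundary Omega (x + r *: f).
    by move=> /negP xab /slab; rewrite dotDr dotZr ef mulr0 addr0.
  have O1 : Omega (p + s *: f).
    apply: (segment_in_open oO _ Op) => r _; rewrite [p + _ - p]addrC addKr scalerA; exact: vert.
  have O2 : Omega (q + s *: f).
    apply: (segment_in_open oO _ O1) => r /andP[r0 r1] /fM; apply/negP; rewrite -ltNge.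
    rewrite dotDr dotZr dotBr.
    move: (dot f (p + s *: f)) (dot f (q + s *: f)) ps qs => u v Mu Mv.
    have -> : u + r * (v - u) = M + ((1 - r) * (u - M) + r * (v - M)) by ring.
    rewrite ltrDl; have [->|rn1] := eqVneq r 1; first by rewrite subrr mul0r add0r mul1r subr_gt0.
    by rewrite ltr_wpDr ?mulr_gt0 ?mulr_ge0 ?subr_ge0 ?subr_gt0 ?(ltW Mv) // lt_neqAle rn1.
  apply: (segment_in_open oO _ O2) => r _.
  rewrite opprD addrA subrr sub0r scalerN scalerA -addrA -scaleNr -scalerDl; exact: vert.
have [[p [pab Op]]|noO] := pselect (exists p, ~~ (a <= dot e p <= b) /\ Omega p); [right|left] => y.
  by move=> nOy; apply/negPn/negP => yab; apply: nOy; exact: (same p).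
by move=> Oy; apply/negPn/negP => yab; apply: noO; exists y.
Qed.

End slab_sides.

(** * The normal at a point of contact with a supporting hyperplane *)

Section gradient_direction.
Context (R : realType) (m : nat).
Local Notation E := 'rV[R]_m.

(** If the open half-space of directions increasing along [g] contains no
    direction increasing along [e], then [g] is a nonpositive multiple of [e]:
    otherwise the component of [g] orthogonal to [e], tilted slightly towards
    [e], would increase along both. *)
Lemma dot_gradient_eq (g e : E) : dot e e = 1 ->
  (forall v, 0 < dot g v -> dot e v <= 0) -> g = - enorm g *: e.
Proof.
move=> e1 H; set c := dot e g.
have rej : dot g (g - c *: e) = dot g g - c ^+ 2.
  by rewrite dotBr dotZr (dotC g e) -/c expr2.
have gge : dot g g = c ^+ 2.
  have := dotvv_ge0 (g - c *: e); rewrite (dot_reject _ e1) -/c -rej le_eqVlt.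
  case/orP => [/eqP E0|gt0]; first by apply/eqP; rewrite -subr_eq0 -rej -E0.
  (* the tilt: small enough for d |c| to stay below <g, g - c e> *)
  pose d := dot g (g - c *: e) / (2 * (`|c| + 1)).
  have c1 : 0 < `|c| + 1 by rewrite ltr_wpDl.
  have d0 : 0 < d by rewrite divr_gt0 // mulr_gt0.
  have E1 : dot e (g - c *: e + d *: e) = d.
    by rewrite dotDr dotBr !dotZr e1 !mulr1 -/c subrr add0r.
  have := H (g - c *: e + d *: e); rewrite E1 dotDr dotZr (dotC g e) -/c => H'.
  suff /H' : 0 < dot g (g - c *: e) + d * c by rewrite leNgt d0.
  have dE : dot g (g - c *: e) = d * (2 * (`|c| + 1)) by rewrite /d divfK // gt_eqF // mulr_gt0.
  rewrite {1}dE -mulrDr mulr_gt0 //.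
  by have := ler_norm (- c); rewrite normrN; have := normr_ge0 c; move: `|c| => r; lra.
have gce : g = c *: e.
  apply/eqP; rewrite -subr_eq0; apply/eqP/dotvv_eq0.
  by rewrite (dot_reject _ e1) -/c gge subrr.
have c0 : c <= 0.
  have [//|c0] := leP c 0; have := H g; rewrite gge exprn_gt0 // => /(_ isT).
  by rewrite -/c leNgt c0.
have -> : enorm g = - c.
  by rewrite -(ler0_norm c0) -sqrtr_sqr -gge /enorm; congr Num.sqrt; apply: eq_bigr => i _; rewrite expr2.
by rewrite opprK.
Qed.

Lemma partial_MVT (rho : E -> R) (x : E) (i : 'I_m) (t : R) :
  (forall s, `|s| <= `|t| -> derivable rho (x + s *: delta_mx ord0 i) (delta_mx ord0 i)) ->
  exists2 s, `|s| <= `|t| &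
    rho (x + t *: delta_mx ord0 i) - rho x = partial i rho (x + s *: delta_mx ord0 i) * t.
Proof.
move=> H; set d := delta_mx ord0 i : E; pose f s := rho (x + s *: d).
have df (s : R) : `|s| <= `|t| -> is_derive s 1 f (partial i rho (x + s *: d)).
  move=> st; have ds := H s st.
  have E1 : (fun h => h^-1 *: ((f \o shift s) (h *: 1) - f s)) =
      (fun h => h^-1 *: ((rho \o shift (x + s *: d)) (h *: d) - rho (x + s *: d))).
    apply/funext => h; rewrite /f /= /shift /= [h *: 1]mulr1 scalerDl.
    by congr (_ *: (rho _ - _)); rewrite addrCA.
  by apply: DeriveDef; rewrite ?/derivable ?/partial ?/derive E1.
have [t0|t0] := leP 0 t.
  have [||s sI] := @MVT_segment R f (fun s => partial i rho (x + s *: d)) 0 t t0.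
  - by move=> s; rewrite in_itv /= => /andP[s0 st]; apply: df; rewrite !ger0_norm // ltW.
  - apply: derivable_within_continuous => s; rewrite in_itv /= => /andP[s0 st].
    by have [] := df s; rewrite ?ger0_norm.
  move: sI; rewrite in_itv /= => /andP[s0 st]; rewrite /f scale0r addr0 subr0 => E1.
  by exists s => //; rewrite !ger0_norm.
have [||s sI] := @MVT_segment R f (fun s => partial i rho (x + s *: d)) t 0 (ltW t0).
- by move=> s; rewrite in_itv /= => /andP[ts s0]; apply: df; rewrite !ltr0_norm // lerN2 ltW.
- apply: derivable_within_continuous => s; rewrite in_itv /= => /andP[ts s0].
  by have [] := df s; rewrite ?(ltr0_norm t0) ?ler0_norm // lerN2.
move: sI; rewrite in_itv /= => /andP[ts s0]; rewrite /f scale0r addr0 sub0r => E1.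
exists s; first by rewrite (ltr0_norm t0) ler0_norm // lerN2.
by rewrite -opprB E1 mulrN opprK.
Qed.

End gradient_direction.

Section defining_function.
Context (R : realType) (m : nat).
Local Notation E := 'rV[R]_m.

(** Continuous partial derivatives give differentiability: change the coordinates
    one at a time, and apply the mean value theorem to each change. *)
Lemma C1_increment (U : set E) (rho : E -> R) (y : E) (eps : R) : open U -> U y ->
  C2_on U rho -> 0 < eps ->
  exists2 delta, 0 < delta & forall w : E, (forall i, `|w ord0 i| < delta) ->
    `|rho (y + w) - rho y - dot (gradient rho y) w| <= eps * \sum_i `|w ord0 i|.
Proof.
move=> oU Uy [_ dU cU _ _] eps0.
have [d d0 dP] : exists2 d, 0 < d & forall z, ball y d z ->
    U z /\ forall i, `|partial i rho z - partial i rho y| <= eps.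
  suff /nbhs_ballP[d /= d0 dP] : \forall z \near y,
      U z /\ forall i, `|partial i rho z - partial i rho y| <= eps by exists d.
  apply: filterI; first exact: oU.
  have : forall i, nbhs y (fun z => `|partial i rho z - partial i rho y| <= eps); last first.
    by move=> H; exact: (@filter_forall _ _ _ (nbhs y) _ H).
  move=> i.
  have /cvgr_dist_le/(_ eps eps0) : partial i rho z @[z --> y] --> partial i rho y.
    by apply: cU; rewrite inE.
  by apply: filterS => z; rewrite distrC.
(* tr k is w with all but its first k coordinates set to zero *)
exists d => // w wd; pose tr k : E := \row_i (if (i < k)%N then w ord0 i else 0).
suff H k : (k <= m)%N ->
    `|rho (y + tr k) - rho y - \sum_(i < m | (i < k)%N) gradient rho y ord0 i * w ord0 i|
      <= eps * \sum_(i < m | (i < k)%N) `|w ord0 i|.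
  have := H m (leqnn m); rewrite (_ : tr m = w); last first.
    by apply/rowP => i; rewrite mxE ltn_ord.
  have allP (F : 'I_m -> R) : \sum_(i < m | (i < m)%N) F i = \sum_i F i.
    by apply: eq_bigl => i; rewrite ltn_ord.
  by rewrite !allP.
elim: k => [_|k IH km].
  rewrite !big_pred0 // mulr0 subr0 (_ : tr 0%N = 0) ?addr0 ?subrr ?normr0 //.
  by apply/rowP => i; rewrite !mxE.
pose i0 := Ordinal km.
have trS : tr k.+1 = tr k + w ord0 i0 *: delta_mx ord0 i0.
  apply/rowP => i; rewrite !mxE ltnS leq_eqVlt /=.
  have [->|ne] := eqVneq i i0; first by rewrite eqxx ltnn add0r mulr1.
  by rewrite -(inj_eq val_inj) /= in ne; rewrite (negbTE ne) mulr0 addr0.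
have sumS (F : 'I_m -> R) : \sum_(i < m | (i < k.+1)%N) F i = F i0 + \sum_(i < m | (i < k)%N) F i.
  rewrite (bigD1 i0) //=; congr (_ + _); apply: eq_bigl => i.
  by rewrite ltnS -(inj_eq val_inj) /= [RHS]ltn_neqAle andbC.
have inball (s : R) : `|s| <= `|w ord0 i0| -> ball y d (y + tr k + s *: delta_mx ord0 i0).
  move=> sw; apply/rV_ballE; split => // i; rewrite !mxE /=.
  have [->|ne] := eqVneq i i0; first by rewrite ltnn addr0 mulr1 opprD addNKr normrN (le_lt_trans sw).
  rewrite mulr0 addr0 opprD addNKr normrN.
  by case: ifP => // _; rewrite normr0.
have [|s sw sE] := @partial_MVT R m rho (y + tr k) i0 (w ord0 i0).
  by move=> s /inball/dP[Us _]; exact: dU.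
have [_ /(_ i0) ps] := dP _ (inball _ sw).
rewrite trS addrA !sumS mulrDr (addrC (eps * `|w ord0 i0|)).
set X := rho (y + tr k + _); set a := rho y; set S := \sum_(i | _) _ * _.
set g0 := gradient rho y ord0 i0.
have -> : X - a - (g0 * w ord0 i0 + S) = (rho (y + tr k) - a - S) +
    ((partial i0 rho (y + tr k + s *: delta_mx ord0 i0) - g0) * w ord0 i0).
  have -> : X = rho (y + tr k) + partial i0 rho (y + tr k + s *: delta_mx ord0 i0) * w ord0 i0.
    by rewrite -sE addrC subrK.
  by ring.
apply: (le_trans (ler_normD _ _)); apply: lerD; first by apply: IH; exact: ltnW.
by rewrite normrM ler_wpM2r // /g0 mxE.
Qed.

Lemma C1_directional (U : set E) (rho : E -> R) (y v : E) : open U -> U y ->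
  C2_on U rho -> 0 < dot (gradient rho y) v ->
  exists s, [/\ 0 < s, U (y + s *: v), U (y - s *: v),
    rho y < rho (y + s *: v) & rho (y - s *: v) < rho y].
Proof.
move=> oU Uy C2 gv; set G := dot _ _ in gv.
pose V := \sum_i `|v ord0 i|; have V0 : 0 <= V by rewrite sumr_ge0.
have V1 : 0 < V + 1 by rewrite ltr_wpDl.
have eps0 : 0 < G / (V + 1) by rewrite divr_gt0.
have [d d0 dP] := C1_increment oU Uy C2 eps0.
have [d' d'0 dU] : exists2 d', 0 < d' & forall z, ball y d' z -> U z.
  by have /nbhs_ballP[d' d'0 dU] := oU y Uy; exists d'.
pose r := Num.min d d' / (V + 1).
have r0 : 0 < r by rewrite divr_gt0 // lt_min d0 d'0.
have rv (s : R) i : `|s| = r -> `|(s *: v) ord0 i| < Num.min d d'.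
  move=> sr; rewrite mxE normrM sr /r mulrAC -mulrA -[ltRHS]mulr1 ltr_pM2l ?lt_min ?d0 ?d'0 //.
  rewrite ltr_pdivrMr // mul1r; apply: (@le_lt_trans _ _ V); last by rewrite ltrDl.
  by rewrite /V (bigD1 i) //= lerDl sumr_ge0.
have inU s : `|s| = r -> U (y + s *: v).
  move=> sr; apply: dU; apply/rV_ballE; split => // i.
  rewrite mxE opprD addNKr normrN; apply: lt_le_trans (rv _ _ sr) _.
  by rewrite ge_min lexx orbT.
have incr s : `|s| = r -> `|rho (y + s *: v) - rho y - s * G| < r * G.
  move=> sr; have /dP : forall i, `|(s *: v) ord0 i| < d.
    by move=> i; apply: lt_le_trans (rv _ i sr) _; rewrite ge_min lexx.
  rewrite dotZr => /le_lt_trans; apply.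
  have -> : \sum_i `|(s *: v) ord0 i| = r * V.
    by rewrite /V mulr_sumr; apply: eq_bigr => i _; rewrite mxE normrM sr.
  by rewrite mulrCA ltr_pM2l // mulrAC ltr_pdivrMr // ltr_pM2l // ltrDl.
have rr : `|r| = r by rewrite gtr0_norm.
have rN : `|- r| = r by rewrite normrN.
exists r; rewrite -scaleNr; split; [exact: r0|exact: inU|exact: inU| |].
  have := incr r rr; rewrite ltr_norml => /andP[+ _].
  by move: (rho _) (rho _) (r * G) => a b c; lra.
have := incr _ rN; rewrite ltr_norml mulNr => /andP[_ +].
by move: (rho _) (rho _) (r * G) => a b c; lra.
Qed.

Variables (Omega : set E) (e y nu : E).
Hypotheses (oO : open Omega) (By : boundary Omega y) (e1 : dot e e = 1).

Let notOmega : ~ Omega y.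
Proof. by case: By => _; rewrite (interior_id Omega).1. Qed.

(** On the boundary of an open set the defining function is nonnegative, and a
    positive value would persist on a neighbourhood, which meets [Omega]. *)
Lemma defining_boundary U rho : C2_defining Omega U rho y -> rho y = 0.
Proof.
move=> [oU Uy [cr _ _ _ _] _ rO]; apply: le_anti; apply/andP; split; last first.
  by rewrite leNgt; apply/negP => /(rO y Uy).2.
rewrite leNgt; apply/negP => ry.
have : nbhs y [set z | U z /\ 0 < rho z].
  apply: filterI; first exact: oU.
  have : rho z @[z --> y] --> rho y by apply: cr; rewrite inE.
  by move=> /cvgr_gt/(_ 0 ry).
move=> /By.1 [z [Oz [Uz rz]]].
by have := (rO z Uz).1 Oz; rewrite ltNge ltW.
Qed.

(** Moving from [y] in a direction where the defining function decreases leads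
    into [Omega], hence does not increase <., e>. *)
Lemma inside_normal : exterior_unit_normal Omega y nu ->
  (forall z, Omega z -> dot e z <= dot e y) -> nu = e.
Proof.
move=> [U [rho [D ->]]] sup; have r0 := defining_boundary D.
case: D => oU Uy C2 gne rO; set g := gradient rho y.
have gE : - g = - enorm (- g) *: e.
  apply: dot_gradient_eq => // v; rewrite dotNl -dotNr => gv.
  have [s [s0 _ Us _ rs]] := C1_directional oU Uy C2 gv.
  have /sup : Omega (y - s *: - v) by apply/(rO _ Us); rewrite -r0.
  by rewrite scalerN opprK dotDr dotZr gerDl pmulr_rle0.
rewrite enormN scaleNr in gE; move/oppr_inj : gE => gE.
have g0 : enorm g != 0.
  by apply: contraNneq (gne y Uy) => g0; rewrite -/g gE g0 scale0r.
by rewrite [X in _ *: X]gE scalerA mulVf // scale1r.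
Qed.

(** The mirror case, in which the complement of [Omega] is on the inner side of
    the hyperplane: now the directions where the defining function increases
    do not increase <., e>. *)
Lemma outside_normal : exterior_unit_normal Omega y nu ->
  (forall z, ~ Omega z -> dot e z <= dot e y) -> nu = - e.
Proof.
move=> [U [rho [D ->]]] sup; have r0 := defining_boundary D.
case: D => oU Uy C2 gne rO; set g := gradient rho y.
have gE : g = - enorm g *: e.
  apply: dot_gradient_eq => // v gv.
  have [s [s0 Us _ rs _]] := C1_directional oU Uy C2 gv.
  have : ~ Omega (y + s *: v) by move/(rO _ Us).1; rewrite ltNge ltW // -r0.
  by move=> /sup; rewrite dotDr dotZr gerDl pmulr_rle0.
have g0 : enorm g != 0.
  by apply: contraNneq (gne y Uy) => g0; rewrite -/g gE g0 oppr0 scale0r.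
by rewrite [X in _ *: X]gE scalerA mulrN mulVf // scaleN1r.
Qed.

End defining_function.

(** * Speed of the contact points *)

Section contact_speed.
Context (R : realType) (n : nat) (alpha : R).
Hypotheses (n1 : (1 <= n)%N) (alpha0 : 0 < alpha).
Local Notation E := 'rV[R]_n.+1.

(** The velocity prescribed by the flow is invariant under exchanging [Omega] with
    its exterior, because curvature and normal both change sign.  So it does not
    matter on which side of its boundary the set lies. *)
Lemma contact_speed (Omega : set E) (e y nu : E) W : open Omega ->
  bounded_set (boundary Omega) -> boundary Omega y -> dot e e = 1 -> 0 < W ->
  (forall z, boundary Omega z -> dot e y - W <= dot e z <= dot e y) ->
  exterior_unit_normal Omega y nu -> pv_converges alpha Omega y ->
  dot e (- frac_mean_curvature alpha Omega y *: nu) <=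
    - (alpha / 2 * slab_bound n.+1 alpha W).
Proof.
move=> oO bB By e1 W0 slab nuP pv.
have nearW : \forall eps \near (0 : R)^'+, 0 < eps <= W.
  near=> eps; apply/andP; split; near: eps; [exact: nbhs_right_gt|exact: nbhs_right_le].
have mO := open_measurable_rV oO.
have truncE eps0 : truncated_curvature alpha Omega y eps0 =
    \int[lebesgue_rV R n.+1]_(z in far y eps0) (indic_sign Omega z * kernel alpha y z) by [].
have a0 : 0 <= alpha / 2 by rewrite divr_ge0 // ltW.
rewrite dotZr mulNr lerN2 /frac_mean_curvature -[leRHS]mulrA.
apply: ler_wpM2l => //.
have [ins|out] := slab_sides n1 oO bB slab.
  rewrite (inside_normal oO By e1 nuP); last by move=> z /ins/andP[].
  rewrite e1 mulr1; apply: limr_ge => //.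
  apply: filterS nearW => eps /andP[eps0 epsW]; rewrite truncE.
  exact: (truncated_slab_bound alpha0 mO e1 eps0 epsW ins).
rewrite (outside_normal oO By e1 nuP); last by move=> z /out/andP[].
rewrite dotNr e1 mulrN1 lerNr; apply: limr_le => //.
apply: filterS nearW => eps /andP[eps0 epsW]; rewrite truncE.
have mOC := measurableC mO.
rewrite lerNr; apply: (le_trans (truncated_slab_bound alpha0 mOC e1 eps0 epsW out)).
rewrite -mulN1r -RintegralZl //; last 2 first.
- exact: measurable_far.
- exact: signed_kernel_integrable.
rewrite le_eqVlt; apply/orP; left; apply/eqP; apply: eq_Rintegral => z _.
by rewrite mulN1r -mulNr /indic_sign setCK opprB.
Unshelve. all: by end_near.
Qed.

End contact_speed.

(** * A maximum principle along continuous motions *)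

Section max_decreases.
Context (R : realType) (m : nat).
Local Notation E := 'rV[R]_m.

(** Continuity on K x [0, b], phrased with neighbourhoods in the ambient space so
    that the near-covering form of compactness applies to it. *)
Definition jointly_continuous (K : set E) (b : R) (F : E -> R -> R) :=
  forall x t eps, K x -> 0 <= t <= b -> 0 < eps ->
  \forall q \near (x, t), K q.1 -> 0 <= q.2 <= b -> `|F q.1 q.2 - F x t| < eps.

Lemma jointly_continuous_slice K b F t : jointly_continuous K b F -> 0 <= t <= b ->
  {within K, continuous (F ^~ t)}.
Proof.
move=> cF tb; apply/subspace_continuousP => x Kx; apply/cvgrPdist_lt => eps eps0.
have [[A B] /= [nA nB] AB] := cF x t eps Kx tb eps0.
rewrite near_withinE; apply: filterS nA => x' Ax' Kx'.
by rewrite distrC; apply: (AB (x', t)) => //; split => //=; exact: nbhs_singleton.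
Qed.

(** Let v be the value of [F] at [x] and time [b], and take the infimum of the
    times at which the value v is attained or exceeded somewhere on [K].  It is attained, by
    compactness; were it positive, the hypothesis applied to a maximiser at that
    time would give an earlier one. *)
Lemma max_decreases (K : set E) (b : R) (F : E -> R -> R) : compact K -> 0 <= b ->
  jointly_continuous K b F ->
  (forall t x, 0 < t <= b -> K x -> (forall x', K x' -> F x' t <= F x t) ->
     exists2 h, 0 < h <= t & F x t <= F x (t - h)) ->
  forall x, K x -> exists2 x', K x' & F x b <= F x' 0.
Proof.
move=> cK b0 cF back x1 Kx1; set v := F x1 b.
pose S := [set s | 0 <= s <= b /\ exists2 x, K x & v <= F x s].
have Sb : S b by split; [rewrite b0 lexx|exists x1].
have lS : lbound S 0 by move=> s [/andP[]].
have iS : has_inf S by split; [exists b|exists 0].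
pose s0 := inf S.
have s00 : 0 <= s0 by apply: lb_le_inf => //; exists b.
have s0b : s0 <= b by apply: ge_inf => //; exists 0.
have s0I : 0 <= s0 <= b by rewrite s00 s0b.
have Ss0 : exists2 x, K x & v <= F x s0.
  apply: contrapT => nS.
  have lt x : K x -> F x s0 < v.
    by move=> Kx; rewrite ltNge; apply/negP => vF; apply: nS; exists x.
  have nc : near_covering_within K by apply/near_covering_withinP/compact_near_coveringP.
  have : \forall s \near s0, K `<=` (fun x => 0 <= s <= b -> F x s < v).
    apply: (nc _ (nbhs s0) (fun s x => 0 <= s <= b -> F x s < v)) => x Kx.
    have e0 : 0 < v - F x s0 by rewrite subr_gt0 lt.
    have := cF x s0 _ Kx s0I e0.
    apply: filterS => -[x' s] /= H Kx' sb; have := H Kx' sb.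
    by rewrite ltr_norml ltrD2r => /andP[].
  move=> /nbhs_ballP[d /= d0 dP].
  have [s [sb [x Kx vF]] sd] := inf_adherent d0 iS.
  have s0s : s0 <= s by apply: ge_inf; [exists 0|split => //; exists x].
  have : F x s < v.
    apply: (dP s) => //; rewrite /ball /= distrC ger0_norm ?subr_ge0 //.
    by rewrite ltrBlDl.
  by rewrite ltNge vF.
have K0 : K !=set0 by exists x1.
have [x0 /[!inE] Kx0 x0max] := compact_EVT_max K0 cK (jointly_continuous_slice cF s0I).
have vF0 : v <= F x0 s0.
  by have [x Kx vF] := Ss0; apply: (le_trans vF); apply: x0max; rewrite inE.
have [s0E|s0N] := eqVneq s0 0; first by exists x0 => //; rewrite -s0E.
have s0gt : 0 < s0 by rewrite lt_neqAle eq_sym s0N s00.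
have s0gt' : 0 < s0 <= b by rewrite s0gt s0b.
have x0max' x : K x -> F x s0 <= F x0 s0 by move=> Kx; apply: x0max; rewrite inE.
have [h /andP[h0 hs] hF] := back s0 x0 s0gt' Kx0 x0max'.
have Sh : S (s0 - h).
  split; first by rewrite subr_ge0 hs (le_trans _ s0b) // gerBl ltW.
  by exists x0 => //; exact: le_trans hF.
have : s0 <= s0 - h by apply: ge_inf => //; exists 0.
by rewrite lerBrDr gerDl leNgt h0.
Qed.

(** A negative derivative at [t] means larger values just before [t]: the speed of
    a single moving point becomes the backward estimate of [max_decreases]. *)
Lemma velocity_backward n (p : R -> 'rV[R]_n.+1) t v e k : 0 < t -> velocity p t v ->
  dot e v + k < 0 ->
  exists2 h, 0 < h <= t & dot e (p t) + k * t <= dot e (p (t - h)) + k * (t - h).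
Proof.
move=> t0 vel vk.
have cvk : dot e (h^-1 *: (p (t + h) - p t)) @[h --> within [set h | 0 <= t + h] 0^'] --> dot e v.
  by apply: continuous_cvg vel; exact: dot_continuous.
have e0 : 0 < - (dot e v + k) by rewrite oppr_gt0.
have /cvgr_dist_lt/(_ _ e0) := cvk.
rewrite near_withinE /= => /nbhs_ballP[d /= d0 dP].
pose h := Num.min (d / 2) t.
have h0 : 0 < h by rewrite lt_min t0 divr_gt0.
have ht : h <= t by rewrite ge_min lexx orbT.
exists h; first by rewrite h0 ht.
have := dP (- h); rewrite /ball /= sub0r opprK gtr0_norm // oppr_eq0 gt_eqF // subr_ge0 ht.
have hd : h < d by rewrite gt_min; apply/orP; left; rewrite ltr_pdivrMr // ltr_pMr // ltr1n.
move=> /(_ hd isT isT); rewrite ltr_norml => /andP[+ _].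
rewrite dotZr dotBr; set a := dot e (p t); set c := dot e (p (t - h)).
rewrite opprK ltrBrDl => H.
have {}H : (- h)^-1 * (c - a) < - k by move: H; move: (_ * _) => r; lra.
rewrite invrN mulNr ltrN2 mulrC ltr_pdivlMr // in H.
by rewrite mulrBr; move: H; move: (k * h) (k * t) => r s; lra.
Qed.

End max_decreases.

(** * Extinction time in terms of the width *)

Section flow_extinction.
Context (R : realType) (n : nat) (alpha : R).
Hypotheses (n1 : (1 <= n)%N) (alpha0 : 0 < alpha).
Local Notation E := 'rV[R]_n.+1.

Lemma boundary_sub_closure (T : topologicalType) (A : set T) : boundary A `<=` closure A.
Proof. by move=> x []. Qed.

Lemma closed_boundary (T : topologicalType) (A : set T) : closed (boundary A).
Proof.
rewrite /boundary setDE; apply: closedI; first exact: closed_closure.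
by apply: open_closedC; exact: open_interior.
Qed.

Lemma bounded_closure_rV (A : set E) : bounded_set A -> bounded_set (closure A).
Proof.
move=> [L [Lr bL]]; exists (L + 1); split; first exact: num_real.
move=> M LM x clx.
have AB : A `<=` [set y : E | `|y| <= M].
  by apply: bL; apply: lt_trans LM; rewrite ltrDl.
have : closed [set y : E | `|y| <= M].
  by apply: (@closed_comp E R (fun y => `|y|) [set r | r <= M]); [move=> y _; exact: norm_continuous|exact: closed_le].
by move=> /closure_id ->; apply: closureS clx.
Qed.

Lemma compact_boundary (A : set E) : bounded_set A -> compact (boundary A).
Proof.
move=> bA; apply: bounded_closed_compact; last exact: closed_boundary.
move: (bounded_closure_rV bA) => [L [Lr bL]]; exists L; split => // M LM x /boundary_sub_closure; exact: bL.
Qed.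

(** A first application of [max_decreases], with speed zero, bounds the width in
    direction [e] by its initial bound [W] at all times.  A second one, with a
    positive speed [k], shows that the extreme values of <., e> approach each
    other at speed 2k; since they cannot cross, time is at most W / 2k.  Here [k]
    is half the bound of [contact_speed], which leaves room for the strict
    inequality that [velocity_backward] requires. *)
Lemma flow_extinction (Omega : R -> set E) (e : E) (W t0 : R) :
  bounded_set (Omega 0) -> frac_mean_curvature_flow alpha Omega ->
  dot e e = 1 -> 0 < W ->
  (forall x y, boundary (Omega 0) x -> boundary (Omega 0) y -> dot e (x - y) <= W) ->
  boundary (Omega 0) !=set0 -> regular_until Omega t0 ->
  t0 <= W / (alpha / 2 * slab_bound n.+1 alpha W).
Proof.
move=> bO [oO [X [X0 Xim Xc Xv]]] e1 W0 width [x1 Bx1] reg.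
set K := boundary (Omega 0) in X0 Xim Xc Xv width x1 Bx1 *.
have cK : compact K by exact: compact_boundary.
set D := [set q | _] in Xc.
have /subspace_continuousP XcP := Xc.
have tmax t : t < t0 -> (t%:E < maximal_time Omega)%E.
  by move=> tt0; apply: (@lt_le_trans _ _ t0%:E); [rewrite lte_fin|apply: ereal_sup_ubound; exists t0].
have kap0 V : 0 < V -> 0 < alpha / 2 * slab_bound n.+1 alpha V.
  move=> V0; apply: mulr_gt0; [exact: divr_gt0|exact: slab_bound_gt0].
have Fc u k b : b < t0 -> jointly_continuous K b (fun x t => dot u (X x t) + k * t).
  move=> bt0 x t eps Kx /andP[tb0 tb] eps0.
  have Dxt : D (x, t) by split => //; split => //; apply: tmax; exact: le_lt_trans bt0.
  have cX := XcP (x, t) Dxt.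
  have cF : (fun q : E * R => dot u (X q.1 q.2) + k * q.2) @ within D (nbhs (x, t)) --> dot u (X x t) + k * t.
    apply: cvgD.
      by apply: continuous_cvg cX; exact: dot_continuous.
    apply: cvgM; first exact: cvg_cst.
    by apply: cvg_within_filter; exact: cvg_snd.
  have /cvgrPdist_lt/(_ _ eps0) := cF.
  rewrite near_withinE; apply: filterS => q /= H Kq /andP[q0 qb].
  rewrite distrC; apply: H; split => //; split => //; apply: tmax; exact: le_lt_trans bt0.
(* at time t, a bound V on the width gives the decrease of contact points *)
have back u k V t x : dot u u = 1 -> 0 < V -> 0 < t -> t < t0 ->
    (forall y z, K y -> K z -> dot u (X y t - X z t) <= V) ->
    k < alpha / 2 * slab_bound n.+1 alpha V -> K x ->
    (forall x', K x' -> dot u (X x' t) + k * t <= dot u (X x t) + k * t) ->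
    exists2 h, 0 < h <= t & dot u (X x t) + k * t <= dot u (X x (t - h)) + k * (t - h).
  move=> u1 V0 tgt tt0 wV kV Kx xmax.
  have [nu [nuP pv vel]] := Xv x t Kx (ltW tgt) (tmax _ tt0).
  have imE := Xim t (ltW tgt) (tmax _ tt0).
  apply: (velocity_backward tgt vel).
  rewrite -ltrBrDr sub0r; apply: (@le_lt_trans _ _ (- (alpha / 2 * slab_bound n.+1 alpha V))); last by rewrite ltrN2.
  apply: contact_speed => //; first exact: (oO _ (ltW tgt)).
  - rewrite -imE; apply: compact_bounded; apply: continuous_compact => //.
    apply/subspace_continuousP => y Ky.
      have Dyt : D (y, t) by split => //; split => //=; [exact: ltW|exact: tmax].
    have cX := XcP (y, t) Dyt.
    apply: cvg_trans cX => P /= [[A B] /= [nA nB] AB].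
    change (nbhs y (fun z => K z -> P (X z t))); apply: filterS nA => z Az Kz.
    apply: (AB (z, t)); first by split => //=; exact: nbhs_singleton.
    by split => //; split => //=; [exact: ltW|exact: tmax].
  - by rewrite -imE; exists x.
  - move=> z; rewrite -imE => -[y Ky <-].
    have := wV x y Kx Ky; rewrite dotBr lerBlDr addrC -lerBlDr => ->.
    by have := xmax y Ky; rewrite lerD2r.
have mono u b x : dot u u = 1 -> 0 <= b -> b < t0 -> K x ->
    exists2 x', K x' & dot u (X x b) <= dot u x'.
  move=> u1 b0 bt0 Kx.
  have [|x' Kx'] := max_decreases cK b0 (Fc u 0 b bt0) _ Kx.
    move=> t y /andP[tgt tb] Ky ymax.
    have tt0 : t < t0 by exact: le_lt_trans bt0.
    have K0 : K !=set0 by exists x1.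
    have tb' : 0 <= t <= b by rewrite ltW.
    have [z /[!inE] Kz zmin] := compact_EVT_min K0 cK (jointly_continuous_slice (Fc u 0 b bt0) tb').
    (* some bound on the width at time t; the resulting speed is positive *)
    pose V := dot u (X y t) - dot u (X z t) + 1.
    have V0 : 0 < V.
      rewrite ltr_wpDl // subr_ge0.
      by have := ymax z Kz; rewrite lerD2r.
    apply: (@back u 0 V) => //; last exact: kap0.
    move=> p q Kp Kq; rewrite dotBr /V.
    have := ymax p Kp; rewrite lerD2r => h1.
    have := zmin q; rewrite inE => /(_ Kq); rewrite lerD2r => h2.
    by rewrite ler_wpDr // lerB.
  by rewrite !mul0r !addr0 X0 // => h; exists x'.
have e1' : dot (- e) (- e) = 1 by rewrite dotNl dotNr opprK.
have width_t b y z : 0 <= b -> b < t0 -> K y -> K z -> dot e (X y b - X z b) <= W.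
  move=> b0 bt0 Ky Kz.
  have [y' Ky' hy] := mono e b y e1 b0 bt0 Ky.
  have [z' Kz' hz] := mono (- e) b z e1' b0 bt0 Kz.
  apply: (le_trans _ (width y' z' Ky' Kz')).
  by move: hz; rewrite !dotNl lerN2 !dotBr => hz; exact: lerB.
set kap := alpha / 2 * slab_bound n.+1 alpha W.
have kap_gt0 : 0 < kap by exact: kap0.
have shrink b : 0 <= b -> b < t0 -> b <= W / kap.
  move=> b0 bt0.
  have half : kap / 2 < kap by rewrite ltr_pdivrMr // ltr_pMr // ltr1n.
  have wN y z t : 0 <= t -> t < t0 -> K y -> K z -> dot (- e) (X y t - X z t) <= W.
    by move=> tp tt0 Ky Kz; rewrite dotNl -dotNr opprB; exact: width_t.
  have [t y /andP[tgt tb] Ky ymax|x' Kx'] := max_decreases cK b0 (Fc e (kap / 2) b bt0) _ Bx1.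
    have tt0 := le_lt_trans tb bt0.
    by apply: (@back e (kap / 2) W) => // p q Kp Kq; apply: width_t => //; exact: ltW.
  have [t y /andP[tgt tb] Ky ymax|x'' Kx''] := max_decreases cK b0 (Fc (- e) (kap / 2) b bt0) _ Bx1.
    have tt0 := le_lt_trans tb bt0.
    by apply: (@back (- e) (kap / 2) W) => // p q Kp Kq; apply: wN => //; exact: ltW.
  rewrite !X0 // !mulr0 !addr0 !dotNl => h2 h1.
  rewrite ler_pdivlMr // mulrC.
  apply: (le_trans _ (width x' x'' Kx' Kx'')); rewrite dotBr.
  move: h1 h2; move: (dot e _) (dot e x') (dot e x'') => r s q h1 h2.
  have : kap / 2 * b + kap / 2 * b <= s - q by lra.
  by rewrite -mulrDl -splitr.
rewrite leNgt; apply/negP => lt0.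
have q0 : 0 <= W / kap by rewrite ltW // divr_gt0.
have [h1 h2] := midf_lt lt0.
have := shrink _ (le_trans q0 (ltW h1)) h2.
by rewrite leNgt h1.
Qed.

End flow_extinction.

(** * Width and inradius of a convex set *)

Section convex_combinations.
Context (R : realType) (m : nat).
Local Notation E := 'rV[R]_m.

Lemma convex_segment (A : set E) (s : R) x y :
  convex_set (A : set (convex_lmodType E)) -> 0 <= s <= 1 -> A x -> A y ->
  A (s *: x + (1 - s) *: y).
Proof.
move=> cA /andP[s0 s1] Ax Ay.
by have := cA x y (Itv01 s0 s1); rewrite !inE => /(_ Ax Ay).
Qed.

Lemma convex_simplex (A : set E) (I : Type) (r : seq I) (p : E) (q : I -> E) (t : I -> R) :
  convex_set (A : set (convex_lmodType E)) -> A p ->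
  (forall i, A (p + q i)) -> (forall i, 0 <= t i) -> \sum_(i <- r) t i <= 1 ->
  A (p + \sum_(i <- r) t i *: q i).
Proof.
move=> cA Ap Aq; elim: r t => [|i r IH] t t0; first by rewrite !big_nil addr0.
rewrite !big_cons => t1.
have S0 : 0 <= \sum_(j <- r) t j by rewrite sumr_ge0.
(* when t i = 1 all other weights vanish; otherwise divide them by 1 - t i *)
have [ti1|ti1] := eqVneq (t i) 1.
  rewrite ti1 scale1r (_ : \sum_(j <- r) _ = 0) ?addr0 //.
  have : \sum_(j <- r) t j <= 0 by rewrite -(gerDl 1) -{1}ti1.
  elim: r {IH t1 S0} => [|j r IHr]; first by rewrite !big_nil.
  rewrite !big_cons => h; have h0 : 0 <= \sum_(j <- r) t j by rewrite sumr_ge0.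
  have := t0 j => tj0.
  by rewrite IHr ?addr0; [have -> : t j = 0 by lra|]; rewrite ?scale0r //; lra.
have ti : t i < 1 by rewrite lt_neqAle ti1 (le_trans _ t1) // lerDl.
have u0 : 0 < 1 - t i by rewrite subr_gt0.
have Au : A (p + \sum_(j <- r) (t j / (1 - t i)) *: q j).
  apply: IH; first by move=> j; rewrite divr_ge0 // ltW.
  by rewrite -mulr_suml ler_pdivrMr // mul1r lerBrDl.
have tI : 0 <= t i <= 1 by rewrite t0 ltW.
have := convex_segment cA tI (Aq i) Au.
rewrite (_ : _ + (1 - _) *: _ = p + (t i *: q i + \sum_(j <- r) t j *: q j)) //.
rewrite !scalerDr addrACA -scalerDl subrKC scale1r; congr (_ + (_ + _)).
by rewrite scaler_sumr; apply: eq_bigr => j _; rewrite scalerA mulrCA divff ?gt_eqF // mulr1.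
Qed.

End convex_combinations.

Section inradius_width.
Context (R : realType) (m : nat).
Local Notation E := 'rV[R]_m.

Lemma det_bound (A : 'M[R]_m) B : (forall i j, `|A i j| <= B) -> `|\det A| <= m`!%:R * B ^+ m.
Proof.
move=> AB; rewrite /determinant (le_trans (ler_norm_sum _ _ _)) //.
apply: (@le_trans _ _ (\sum_(s : 'S_m) B ^+ m)); last by rewrite sumr_const card_Sn mulr_natl.
apply: ler_sum => s _; rewrite normrM normrX normrN1 expr1n mul1r normr_prod.
rewrite -[X in B ^+ X]card_ord -prodr_const.
by apply: ler_prod => i _; rewrite normr_ge0 AB.
Qed.

Definition set_row (A : 'M[R]_m) (j : 'I_m) (v : E) : 'M[R]_m :=
  \matrix_(i, k) if i == j then v ord0 k else A i k.

Lemma det_set_row (A : 'M[R]_m) j v : A \in unitmx ->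
  \det (set_row A j v) = (v *m invmx A) ord0 j * \det A.
Proof.
move=> Au; have d0 : \det A != 0 by rewrite -unitfE -unitmxE.
rewrite /invmx Au -scalemxAr mxE mulrC mulrA divff // mul1r.
rewrite (expand_det_row _ j) mxE; apply: eq_bigr => k _; rewrite !mxE eqxx.
congr (_ * _); rewrite /cofactor; congr (_ * \det _).
by apply/matrixP => a b; rewrite !mxE eq_sym (negbTE (neq_lift _ _)).
Qed.

(** The rows of [M] are the edges from [p] of a simplex whose volume exceeds half
    the supremum.  By Cramer's rule the j-th coordinate of [v] in this basis is
    the ratio by which replacing the j-th vertex by [p + v] multiplies the
    volume, so it is at most 2 in absolute value. *)
Lemma near_maximal_simplex (A : set E) (p : E) : open A -> bounded_set A -> A p ->
  exists2 M : 'M[R]_m, M \in unitmx &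
    (forall i, A (p + row i M)) /\
    (forall v, A (p + v) -> forall j, `|(v *m invmx M) ord0 j| <= 2).
Proof.
move=> oA [L [_ bL]] Ap.
pose D := [set `|\det M| | M in [set M : 'M[R]_m | forall i, A (p + row i M)]].
have Lb v : A v -> `|v| <= `|L| + 1.
  by move=> Av; apply: (bL (`|L| + 1)) => //; rewrite (le_lt_trans (ler_norm _)) // ltrDl.
have D_ub : has_ubound D.
  exists (m`!%:R * ((`|L| + 1) + `|p|) ^+ m) => _ [M MA <-]; apply: det_bound => i j.
  have -> : M i j = (p + row i M - p) ord0 j by rewrite addrC addKr mxE.
  rewrite (le_trans (rV_norm_coord _ _)) // (le_trans (ler_normB _ _)) // lerD2r.
  exact: Lb.
have [d d0 dA] : exists2 d, 0 < d & forall z, ball p d z -> A z.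
  by have /nbhs_ballP[d d0 dU] := oA p Ap; exists d.
pose M0 : 'M[R]_m := (d / 2)%:M.
have d2 : 0 < d / 2 by rewrite divr_gt0.
have M0A i : A (p + row i M0).
  apply: dA; apply/rV_ballE; split => // j; rewrite !mxE opprD addNKr normrN.
  rewrite (@le_lt_trans _ _ (d / 2)) //; last by rewrite ltr_pdivrMr // ltr_pMr // ltr1n.
  by case: eqP => _; rewrite ?mulr1n ?mulr0n ?normr0 ?gtr0_norm // ltW.
have DM0 : D (`|\det M0|) by exists M0.
have M00 : 0 < `|\det M0| by rewrite det_scalar normr_gt0 expf_neq0 // gt_eqF.
have D_sup : has_sup D by split => //; exists `|\det M0|.
have sup0 : 0 < sup D by apply: lt_le_trans M00 _; exact: ub_le_sup.
have sup2 : 0 < sup D / 2 by rewrite divr_gt0.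
have [_ [M MA <-]] := sup_adherent sup2 D_sup.
rewrite {1}[sup D]splitr addrK => Mgt.
have Mu : M \in unitmx.
  by rewrite unitmxE unitfE -normr_gt0 (lt_trans sup2).
exists M => //; split => // v Av j.
have : `|\det (set_row M j v)| <= sup D.
  apply: ub_le_sup => //; exists (set_row M j v) => //= i.
  have [->|ij] := eqVneq i j.
    by rewrite (_ : row j _ = v) //; apply/rowP => k; rewrite !mxE eqxx.
  by rewrite (_ : row i _ = row i M) //; apply/rowP => k; rewrite !mxE (negbTE ij).
rewrite det_set_row // normrM => h.
have dM : 0 < `|\det M| by exact: lt_trans Mgt.
rewrite -(ler_pM2r dM) (le_trans h) // -ler_pdivrMl // mulrC ltW //.
Qed.

End inradius_width.

Section width_inradius.
Context (R : realType) (n : nat).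
Local Notation m := n.+1.
Local Notation E := 'rV[R]_n.+1.

(** Let N be the largest norm of the gradients of the coordinates given by
    [near_maximal_simplex].  Along the gradient of norm N the width is at most
    4 / N, since that coordinate takes values between -2 and 2.  On the other
    hand, around the point all of whose coordinates are 1 / 2m, a displacement
    of size r = 1 / (2 m^2 N) changes each coordinate by at most 1 / 2m, hence
    stays in the simplex. *)
Lemma inradius_width (A : set E) : open A -> bounded_set A ->
  convex_set (A : set (convex_lmodType E)) -> A !=set0 ->
  exists (e c : E) (r : R), [/\ dot e e = 1, 0 < r, cube c r `<=` A &
    forall x y, A x -> A y -> dot e (x - y) <= 8 * m%:R ^+ 2 * r].
Proof.
move=> oA bA cA [p Ap].
have [M Mu [MA Mv]] := near_maximal_simplex oA bA Ap.
(* the gradient of the j-th coordinate *)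
pose col_ j : E := (col j (invmx M))^T.
have tE v j : (v *m invmx M) ord0 j = dot (col_ j) v.
  by rewrite mxE /dot; apply: eq_bigr => k _; rewrite !mxE mulrC.
pose j0 := [arg max_(j > ord0) enorm (col_ j)]%O.
have Nmax j : enorm (col_ j) <= enorm (col_ j0).
  by rewrite /j0; case: arg_maxP => // i _; exact.
set N := enorm (col_ j0) in Nmax.
have m0 : 0 < m%:R :> R by rewrite ltr0n.
have N0 : 0 < N.
  rewrite lt_neqAle enorm_ge0 andbT eq_sym; apply/negP => /eqP N0.
  have : (M *m invmx M) j0 j0 = 0.
    have := tE (row j0 M) j0; rewrite -row_mul mxE => ->.
    suff -> : col_ j0 = 0 by rewrite -(scale0r 0) dotZl mul0r.
    by apply: dotvv_eq0; rewrite -enorm_sqr -/N N0 expr0n.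
  by rewrite mulmxV // mxE eqxx => /eqP; rewrite oner_eq0.
pose e := N^-1 *: col_ j0.
have e1 : dot e e = 1.
  by rewrite dotZl dotZr -enorm_sqr -/N expr2 mulKf ?mulVf // gt_eqF.
pose r := (2 * m%:R ^+ 2 * N)^-1.
have r0 : 0 < r by rewrite invr_gt0 !mulr_gt0 // exprn_gt0.
have Mle v j : A (p + v) -> `|dot (col_ j) v| <= 2.
  by move=> Av; rewrite -tE; exact: Mv.
pose a : R := (2 * m%:R)^-1.
have a0 : 0 < a by rewrite invr_gt0 mulr_gt0.
exists e, (p + \sum_j a *: row j M), r; split => //.
  move=> y yc; pose z := y - (p + \sum_j a *: row j M).
  have zr i : `|z ord0 i| <= r by have := yc i; rewrite !mxE.
  have tz j : `|dot (col_ j) z| <= a.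
    rewrite (le_trans (ler_norm_sum _ _ _)) //.
    apply: (@le_trans _ _ (\sum_(i < m) N * r)).
      apply: ler_sum => i _; rewrite normrM ler_pM //.
      exact: le_trans (coord_le_enorm _ _) (Nmax j).
    rewrite sumr_const card_ord -mulr_natr /r /a le_eqVlt; apply/orP; left; apply/eqP.
    have Nn0 : N != 0 by rewrite gt_eqF.
    have mn0 : m%:R != 0 :> R by rewrite gt_eqF.
    by clear -Nn0 mn0; move: N (m%:R : R) Nn0 mn0 => P Q P0 Q0; field; rewrite P0 Q0.
  have yE : y = p + \sum_j (a + dot (col_ j) z) *: row j M.
    have zE : z = \sum_j dot (col_ j) z *: row j M.
      rewrite -{1}[z]mulmx1 -(mulVmx Mu) mulmxA mulmx_sum_row.
      by apply: eq_bigr => j _; rewrite tE.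
    rewrite [LHS](_ : _ = p + \sum_j a *: row j M + z); last by rewrite addrC subrK.
    rewrite {1}zE -addrA -big_split /=; congr (_ + _).
    by apply: eq_bigr => j _; rewrite scalerDl.
  rewrite yE; apply: convex_simplex => //.
    by move=> j; have := tz j; rewrite ler_norml -subr_ge0 opprK addrC => /andP[].
  apply: (@le_trans _ _ (\sum_(j < m) (a + a))).
    by apply: ler_sum => j _; rewrite lerD2l (le_trans (ler_norm _)).
  by rewrite sumr_const card_ord -mulr2n -mulrnA -mulr_natl natrM divff // gt_eqF // mulr_gt0.
move=> x y Ax Ay.
have xE : A (p + (x - p)) by rewrite addrC subrK.
have yE : A (p + (y - p)) by rewrite addrC subrK.
have -> : x - y = (x - p) - (y - p) by rewrite opprB addrA subrK.
rewrite dotBr !dotZl -mulrBr mulrC ler_pdivrMr //.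
have := Mle _ j0 xE; have := Mle _ j0 yE; rewrite !ler_norml.
have -> : 8 * m%:R ^+ 2 * r * N = 4.
  rewrite /r; have Nn0 : N != 0 by rewrite gt_eqF.
  have mn0 : m%:R != 0 :> R by rewrite gt_eqF.
  by clear -Nn0 mn0; move: N (m%:R : R) Nn0 mn0 => P Q P0 Q0; field; rewrite P0 Q0.
by move: (dot _ _) (dot _ _) => u v /andP[? ?] /andP[? ?]; lra.
Qed.

End width_inradius.

(** * Area of the boundary in terms of the inradius *)

Section hausdorff_lower_bound.
Context (R : realType) (n : nat).
Hypothesis n1 : (1 <= n)%N.
Local Notation E := 'rV[R]_n.+1.

Definition shadow (y : E) : 'rV[R]_n := (rV_uncons y).2.

Lemma shadow_segment (p q : E) s : shadow p = shadow q ->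
  shadow (p + s *: (q - p)) = shadow p.
Proof.
move=> /rowP pq; apply/rowP => i; have := pq i; rewrite !mxE => ->.
by rewrite subrr mulr0 addr0.
Qed.

(** Each line in the direction of the first axis that meets the cube starts inside
    the bounded set [A] and leaves it, so it crosses the boundary. *)
Lemma cube_sub_shadow_boundary (A : set E) c r : open A -> bounded_set A ->
  cube c r `<=` A -> cube (shadow c) r `<=` shadow @` boundary A.
Proof.
move=> oA [L [_ bL]] cA v vc.
have Lb y : A y -> `|y| <= `|L| + 1.
  by move=> Ay; apply: (bL (`|L| + 1)) => //; rewrite (le_lt_trans (ler_norm _)) // ltrDl.
apply: contrapT => nv.
pose p := rV_cons (c ord0 ord0, v); pose q := rV_cons (`|L| + 2, v).
have sh a : shadow (rV_cons (a, v)) = v by rewrite /shadow rV_consK.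
have r0 : 0 <= r by rewrite (le_trans _ (vc (Ordinal n1))).
have Ap : A p.
  apply: cA => i; case: (unliftP ord0 i) => [j ->|->].
    by rewrite /p rV_consS; have := vc j; rewrite !mxE.
  by rewrite /p rV_cons0 subrr normr0.
have Aq : A q.
  apply: (segment_in_open oA _ Ap) => s _ Bs; apply: nv.
  by exists (p + s *: (q - p)) => //; rewrite shadow_segment !sh.
have := le_trans (rV_norm_coord q ord0) (Lb _ Aq).
rewrite /q rV_cons0 /= ger0_norm ?addr_ge0 // lerD2l.
by rewrite leNgt ltr1n.
Qed.

Lemma enorm_le_ediam (F : set E) y z d : F y -> F z -> ediam F = d%:E -> enorm (y - z) <= d.
Proof.
move=> Fy Fz Fd; rewrite -lee_fin -Fd; apply: ereal_sup_ubound; right.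
by exists (y, z).
Qed.

Lemma ediam_fin (F : set E) (delta : R) : (ediam F <= delta%:E)%E ->
  exists2 d, 0 <= d & ediam F = d%:E.
Proof.
move=> Fd; have F0 : (0 <= ediam F)%E by apply: ereal_sup_ubound; left.
have Ff : ediam F \is a fin_num by rewrite ge0_fin_numE // (le_lt_trans Fd) // ltry.
by exists (fine (ediam F)); rewrite ?fineK // fine_ge0.
Qed.

(** The projection of a set of diameter d fits in a cube of half-side d, so the sum
    of the d^n over a cover of the boundary is at least 2^-n times the volume
    of the projected cube, which is (2 r)^n. *)
Lemma hausdorff_delta_ge (A : set E) c r delta : open A -> bounded_set A ->
  cube c r `<=` A -> 0 <= r ->
  ((r ^+ n)%:E <= hausdorff_delta n delta (boundary A))%E.
Proof.
move=> oA bA cA r0; apply: le_ereal_inf_tmp => _ [F [BF Fdelta] <-].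
have /choice[G GP] : forall k, exists G : set 'rV[R]_n, [/\ measurable G,
    shadow @` F k `<=` G & (lebesgue_rV R n G <= (2 ^+ n)%:E * ediam (F k) ^+ n)%E].
  move=> k; have [d d0 dE] := ediam_fin (Fdelta k).
  have [[y Fy]|F0] := pselect (F k !=set0).
    exists (cube (shadow y) d); split; first exact: measurable_cube.
      move=> _ [z Fz <-] i; rewrite !mxE.
      have := le_trans (coord_le_enorm (z - y) (lift ord0 i)) (enorm_le_ediam Fz Fy dE).
      by rewrite !mxE.
    by rewrite dE -EFin_expe -EFinM lebesgue_cube // exprMn.
  exists set0; split => //; first by move=> t [z Fz _]; case: F0; exists z.
  by rewrite measure0 dE -EFin_expe -EFinM lee_fin mulr_ge0 // exprn_ge0.
have : ((lebesgue_rV R n) (cube (shadow c) r) <= \sum_(0 <= k <oo) lebesgue_rV R n (G k))%E.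
  apply: measure_sigma_subadditive.
  - by move=> k; have [] := GP k.
  - exact: measurable_cube.
  - move=> v /(cube_sub_shadow_boundary oA bA cA) [y By <-].
    by have [k _ Fky] := BF y By; exists k => //; have [_ + _] := GP k; apply; exists y.
rewrite lebesgue_cube // => H.
rewrite -(@lee_pmul2l _ (2 ^+ n)%:E) ?lte_fin ?exprn_gt0 //.
rewrite -EFinM -exprMn; apply: (le_trans H).
have ed0 k : (0 <= ediam (F k) ^+ n)%E.
  by have [d d0 ->] := ediam_fin (Fdelta k); rewrite -EFin_expe lee_fin exprn_ge0.
rewrite -nneseriesZl //; apply: lee_nneseries => k _ //.
by have [] := GP k.
Qed.

(** The unit ball contains the cube of half-side 1 / 2n. *)
Lemma unit_ball_ge : (((n%:R^-1) ^+ n)%:E <= lebesgue_rV R n [set v | (enorm v < 1)%R])%E.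
Proof.
have nR : 0 < n%:R :> R by rewrite ltr0n.
have h0 : 0 <= (2 * n%:R)^-1 :> R by rewrite invr_ge0 mulr_ge0.
have := lebesgue_cube (0 : 'rV[R]_n) h0.
rewrite (_ : 2 * (2 * n%:R)^-1 = n%:R^-1); last by rewrite invfM mulrA divff // mul1r.
move=> <-; apply: le_measure; rewrite ?inE.
- exact: measurable_cube.
- rewrite (_ : [set v | _] = setT `&` (fun v => enorm (v - 0)) @^-1` `]-oo, 1[); last first.
    by rewrite setTI; apply/seteqP; split => v /=; rewrite in_itv /= subr0.
  exact: measurable_enorm.
- move=> v vc /=; apply: (@le_lt_trans _ _ (n%:R * (2 * n%:R)^-1)).
    by apply: enorm_le_coord => i; have := vc i; rewrite mxE subr0.
  by rewrite invfM mulrCA divff ?gt_eqF // mulr1 invf_lt1 // ltr1n.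
Qed.

Lemma hausdorff_boundary_ge (A : set E) c r : open A -> bounded_set A ->
  cube c r `<=` A -> 0 <= r ->
  (((r / (2 * n%:R)) ^+ n)%:E <= hausdorff n (boundary A))%E.
Proof.
move=> oA bA cA r0.
have -> : (r / (2 * n%:R)) ^+ n = (n%:R^-1) ^+ n * 2 ^- n * r ^+ n.
  by rewrite -exprVn -!exprMn invfM; congr (_ ^+ _); rewrite mulrC (mulrC 2^-1).
rewrite 2!EFinM /hausdorff; apply: lee_pmul.
- by rewrite lee_fin mulr_ge0 ?exprn_ge0 ?invr_ge0 ?exprn_ge0.
- by rewrite lee_fin exprn_ge0.
- by apply: lee_wpmul2r; [rewrite lee_fin invr_ge0 exprn_ge0|exact: unit_ball_ge].
- apply: (@le_trans _ _ (hausdorff_delta n 1 (boundary A))); first exact: hausdorff_delta_ge cA r0.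
  by apply: ereal_sup_ubound; exists 1 => //=.
Qed.

End hausdorff_lower_bound.

(** * The bound on the maximal time *)

Section width_and_boundary.
Context (R : realType) (n : nat).
Local Notation E := 'rV[R]_n.+1.

Lemma closure_dot_le (A : set E) (e : E) W :
  (forall x y, A x -> A y -> dot e (x - y) <= W) ->
  forall x y, closure A x -> closure A y -> dot e (x - y) <= W.
Proof.
move=> AW.
have half (B : set E) (u : E) M : (forall x, B x -> dot u x <= M) ->
    forall x, closure B x -> dot u x <= M.
  move=> BM x; have : closed [set y | dot u y <= M].
    by apply: (@closed_comp E R (dot u) [set r | r <= M]); [move=> y _; exact: dot_continuous|exact: closed_le].
  by move=> /closure_id cE /(closureS (BM : B `<=` [set y | dot u y <= M])); rewrite -cE.
have h1 y : A y -> forall x, closure A x -> dot e x <= W + dot e y.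
  by move=> Ay; apply: half => x Ax; rewrite -lerBlDr -dotBr AW.
move=> x y cx cy; rewrite dotBr lerBlDr -lerBlDl.
have := half A (- e) (W - dot e x) _ y cy; rewrite dotNl lerNl opprB => -> // z Az.
by rewrite dotNl lerBrDl lerBlDr h1.
Qed.

End width_and_boundary.

Theorem theorem1p4 (R : realType) (n : nat) (alpha : R) :
  (1 <= n)%N -> 0 < alpha < 1 ->
  exists C : R, forall Omega : R -> set 'rV[R]_n.+1,
    bounded_set (Omega 0) ->
    open (Omega 0) ->
    convex_set (Omega 0 : set (convex_lmodType 'rV[R]_n.+1)) ->
    has_C2_boundary (Omega 0) ->
    frac_mean_curvature_flow alpha Omega ->
    (maximal_time Omega <=
       C%:E * hausdorff n (boundary (Omega 0%R)) `^ ((1 + alpha) / n%:R))%E.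
Proof.
move=> n1 /andP[a0 a1].
have m0 : 0 < n.+1%:R :> R by rewrite ltr0n.
have nR : 0 < n%:R :> R by rewrite ltr0n.
pose kap := alpha / 2 * slab_bound n.+1 alpha 1.
have kap0 : 0 < kap by apply: mulr_gt0; [exact: divr_gt0|exact: slab_bound_gt0].
(* the width is k rho, where rho ^+ n is a lower bound for the area *)
pose k : R := 8 * n.+1%:R ^+ 2 * (2 * n%:R).
have k0 : 0 < k by rewrite !mulr_gt0 // exprn_gt0.
exists (k `^ (1 + alpha) / kap) => Omega bO oO cO _ flow.
apply: ge_ereal_sup => _ [t0 reg <-].
have [] := reg => t0_gt0 /(_ 0); rewrite lexx t0_gt0 => /(_ isT) [ne0 _].
have [e [c [r [e1 r0 cr width]]]] := inradius_width oO bO cO ne0.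
have [x Bx _] : [set shadow y | y in boundary (Omega 0)] (shadow c).
  apply: (cube_sub_shadow_boundary n1 oO bO cr) => i.
  by rewrite subrr normr0 ltW.
set W := 8 * n.+1%:R ^+ 2 * r in width.
have W0 : 0 < W by rewrite !mulr_gt0 // exprn_gt0.
have B0 : boundary (Omega 0) !=set0 by exists x.
have widthB y z : boundary (Omega 0) y -> boundary (Omega 0) z -> dot e (y - z) <= W.
  by move=> /boundary_sub_closure cy /boundary_sub_closure cz; exact: (closure_dot_le width).
have t0W := flow_extinction n1 a0 bO flow e1 W0 widthB B0 reg.
pose rho := r / (2 * n%:R); have rho0 : 0 <= rho by rewrite divr_ge0 ?mulr_ge0 // ltW.
have H := hausdorff_boundary_ge n1 oO bO cr (ltW r0).
have WE : W = k * rho.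
  rewrite /W /k /rho -[RHS]mulrA; congr (_ * _).
  by rewrite mulrC divfK // gt_eqF // mulr_gt0.
have tE : t0 <= k `^ (1 + alpha) / kap * (rho ^+ n) `^ ((1 + alpha) / n%:R).
  apply: (le_trans t0W); rewrite slab_boundE //.
  have -> : (rho ^+ n) `^ ((1 + alpha) / n%:R) = rho `^ (1 + alpha).
    by rewrite -powR_mulrn // -powRrM mulrCA divff ?mulr1 // gt_eqF.
  rewrite [leRHS]mulrAC -powRM ?(ltW k0) // -WE le_eqVlt; apply/orP; left; apply/eqP.
  rewrite powRD; last by apply/implyP => _; rewrite gt_eqF.
  by rewrite powRr1 ?(ltW W0) // [alpha / 2 * _]mulrA -/kap invf_div mulrA.
apply: (@le_trans _ _ (k `^ (1 + alpha) / kap * (rho ^+ n) `^ ((1 + alpha) / n%:R))%:E).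
  by rewrite lee_fin.
rewrite EFinM; apply: lee_wpmul2l; first by rewrite lee_fin divr_ge0 ?powR_ge0 // ltW.
rewrite -poweR_EFin; apply: gt0_ler_poweR.
- by rewrite divr_ge0 ?addr_ge0 // ltW.
- by rewrite in_itv /= leey andbT lee_fin exprn_ge0.
- by rewrite in_itv /= leey andbT (le_trans _ H) // lee_fin exprn_ge0.
- exact: H.
Qed.
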